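(* Let $p\ge2$ be an integer, let $G=G_p$ be the Vilenkin group, and suppose $f\in L_2(G)$, $f\neq 0$. Then $$p^{-4}\,UP_G(f)\le UP_\lambda(f)<UP_G(f).$$
   Context: The Vilenkin group $G=G_p$ is the set of sequences $x=(x_j)_{j\in\mathbb{Z}}$ with $x_j\in\{0,\dots,p-1\}$ such that $x_j=0$ for all sufficiently negative $j$; the operation $\oplus$ is coordinatewise addition modulo $p$, with inverse operation $\ominus$ and neutral element $\mathbf{0}$. For $x\ne\mathbf{0}$ let $N(x)$ be the unique integer with $x_{N(x)}\neq0$ and $x_j=0$ for $j<N(x)$; set $\|x\|_G=p^{-N(x)}$ and $\|\mathbf{0}\|_G=0$. Let $\lambda(x)=\sum_{j\in\mathbb{Z}}x_jp^{-j-1}$. The spaces $L_q(G)$ of complex-valued functions are taken with respect to Haar measure. Characters: $\chi(x,\xi)=\exp\left(\frac{2\pi i}{p}\sum_{j\in\mathbb{Z}}x_j\xi_{-1-j}\right)$. Fourier transform: $Ff(\omega)=\int_G f(x)\overline{\chi(x,\omega)}\,dx$ for $f\in L_1(G)$, extended to $L_2(G)$ in the standard way; the Plancherel equality $\langle f,g\rangle=\langle Ff,Fg\rangle$ holds on $L_2(G)$. For $f\in L_2(G)$ define $$V_\lambda(f)=\frac{1}{\|f\|_{L_2(G)}^2}\min_{\tilde x}\int_G(\lambda(x\ominus\tilde x))^2|f(x)|^2\,dx,\qquad V_G(f)=\frac{1}{\|f\|_{L_2(G)}^2}\min_{\tilde x}\int_G\|x\ominus\tilde x\|_G^2|f(x)|^2\,dx,$$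 where the minimum is over $\tilde x\in G$, and the uncertainty products $$UP_\lambda(f)=V_\lambda(f)V_\lambda(Ff),\qquad UP_G(f)=V_G(f)V_G(Ff).$$
   Formalization: The strict inequality UP_λ(f) < UP_G(f) is stated only when UP_G(f) is finite; if UP_G(f) = +∞ (possible for f in L_2(G)), then UP_λ(f) = +∞ too and strictness fails. The lower bound is unconditional. *)

(* Defs.v *)
(* MathComp / MathComp-Analysis *)
From HB Require Import structures.
From mathcomp Require Import all_boot all_order all_algebra.
From mathcomp Require Import complex.
From mathcomp Require Import all_classical all_reals all_analysis.
Set Implicit Arguments.
Unset Strict Implicit.
Unset Printing Implicit Defensive.
Import Order.TTheory GRing.Theory Num.Theory.
Local Open Scope classical_set_scope.
Local Open Scope ring_scope.

(* Digits live in 'Z_p, which is {0, ..., p-1} with addition mod p only when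
   1 < p; everything below is meant under that hypothesis. *)
Definition left_finite (p : nat) : {pred int -> 'Z_p} :=
  fun x => `[< exists n : int, forall j : int, j < n -> x j = 0 >].

Lemma left_finite_zmod (p : nat) : zmod_closed (@left_finite p).
Proof.
split; first by apply/asboolP; exists 0.
move=> x y /asboolP[m xm] /asboolP[n yn]; apply/asboolP.
exists (Num.min m n) => j; rewrite lt_min => /andP[jm jn].
by rewrite -[LHS]/(x j - y j) xm // yn // subrr.
Qed.

HB.instance Definition _ (p : nat) :=
  GRing.isZmodClosed.Build (int -> 'Z_p) (@left_finite p) (left_finite_zmod p).

Record vilenkin (p : nat) : Type := Vilenkin {
  digit :> int -> 'Z_p ;
  digit_left_finite : digit \in @left_finite p }.

HB.instance Definition _ (p : nat) := [isSub for @digit p].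
HB.instance Definition _ (p : nat) := [Choice of vilenkin p by <:].
HB.instance Definition _ (p : nat) :=
  [SubChoice_isSubZmodule of vilenkin p by <:].
HB.instance Definition _ (p : nat) := isPointed.Build (vilenkin p) 0.

(* The group topology: the subgroups {y | y_j = 0 for j < n}, i.e. the balls of
   the norm [vnorm] below, form a base of neighbourhoods of 0. *)
Definition vopen (p : nat) : set (set (vilenkin p)) :=
  [set A : set (vilenkin p) | forall x : vilenkin p, A x ->
     exists n : int, forall y : vilenkin p,
       (forall j : int, j < n -> y j = x j) -> A y].

Lemma vopenT (p : nat) : @vopen p setT.
Proof. by move=> x _; exists 0. Qed.

Lemma vopenI (p : nat) : setI_closed (@vopen p).
Proof.
move=> A B oA oB x [/oA[m Am] /oB[n Bn]]; exists (Num.max m n) => y xy.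
split; [apply: Am|apply: Bn] => j jlt; apply: xy; rewrite lt_max jlt //.
by rewrite orbT.
Qed.

Lemma vopen_bigU (p : nat) (I : Type) (f : I -> set (vilenkin p)) :
  (forall i, vopen (f i)) -> vopen (\bigcup_i f i).
Proof.
by move=> of_ x [i _ /of_[n fn]]; exists n => y xy; exists i => //; exact: fn.
Qed.

HB.instance Definition _ (p : nat) :=
  isOpenTopological.Build (vilenkin p) (@vopenT p) (@vopenI p) (@vopen_bigU p).

(* The Borel sigma-algebra. *)
HB.instance Definition _ (p : nat) :=
  @isMeasurable.Build (sigma_display (@open (vilenkin p))) (vilenkin p)
    <<s @open (vilenkin p) >>
    (@sigma_algebra0 _ setT _)
    (@sigma_algebraC (vilenkin p) _)
    (@sigma_algebra_bigcup _ setT _).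

Section UncertaintyProducts.
Variables (R : realType) (p : nat).
Local Notation G := (vilenkin p).
Local Notation C := R[i].

(* [digit_index x] is N(x) for x != 0; it is irrelevant at x = 0. *)
Definition digit_index (x : G) : int :=
  xget 0 [set n : int | x n != 0 /\ forall j : int, j < n -> x j = 0].

Definition vnorm (x : G) : R :=
  if x == 0 then 0 else p%:R ^ (- digit_index x).

(* The series converges, so that [fine] discards nothing. *)
Definition lambda (x : G) : R :=
  fine (\esum_(j in [set: int]) ((x j : nat)%:R * p%:R ^ (- j - 1) : R)%:E).

(* Only finitely many terms of the sum over all j : int are nonzero. *)
Definition chi (x w : G) : C :=
  let t : R := 2 * pi / p%:R *
    \sum_(j \in [set: int]) (((x j : nat) * (w (- 1 - j)%R : nat))%:R : R) in
  Complex (cos t) (sin t).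

Definition modulus (z : C) : R := ComplexField.Normc.normc z.

Variable mu : {measure set G -> \bar R}.

(* Haar measure; the normalization on {x | x_j = 0 for j < 0} is the one for
   which the Fourier transform below is unitary on L_2. *)
Definition haar_measure : Prop :=
  [/\ forall (a : G) (A : set G), measurable A -> mu [set a + x | x in A] = mu A,
      forall K : set G, compact K -> (mu K < +oo)%E
    & mu [set x : G | forall j : int, j < 0 -> x j = 0] = 1%E].

Definition cmeasurable (f : G -> C) : Prop :=
  measurable_fun [set: G] (fun x => complex.Re (f x)) /\
  measurable_fun [set: G] (fun x => complex.Im (f x)).

Definition cintegral (f : G -> C) : C :=
  Complex (\int[mu]_x complex.Re (f x)) (\int[mu]_x complex.Im (f x)).

Definition normL2sq (f : G -> C) : \bar R :=
  (\int[mu]_x (modulus (f x) ^+ 2)%:E)%E.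

Definition inL1 (f : G -> C) : Prop :=
  cmeasurable f /\ (\int[mu]_x (modulus (f x))%:E < +oo)%E.

Definition inL2 (f : G -> C) : Prop :=
  cmeasurable f /\ (normL2sq f < +oo)%E.

Definition fourierL1 (f : G -> C) (w : G) : C :=
  cintegral (fun x => f x * conjc (chi x w)).

(* [g] is a version of F f, where F is the extension by continuity to L_2 of
   [fourierL1] on the intersection of L_1 and L_2. *)
Definition is_fourierL2 (f g : G -> C) : Prop :=
  inL2 g /\
  exists u : nat -> G -> C,
    [/\ forall n, inL1 (u n) /\ inL2 (u n),
        normL2sq (fun x => u n x - f x) @[n --> \oo] --> 0%E
      & normL2sq (fun w => fourierL1 (u n) w - g w) @[n --> \oo] --> 0%E].

(* [ereal_inf] is the minimum over translations, taken in [0, +oo]: it is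
   attained (by compactness of the closed balls of G when some integral is
   finite), and is +oo when all the integrals diverge. *)
Definition variance_wrt (rho : G -> R) (f : G -> C) : \bar R :=
  (((fine (normL2sq f))^-1)%:E *
   ereal_inf [set \int[mu]_x (rho (x - a) ^+ 2 * modulus (f x) ^+ 2)%:E
             | a in [set: G]])%E.

Definition V_lambda (f : G -> C) : \bar R := variance_wrt lambda f.
Definition V_G (f : G -> C) : \bar R := variance_wrt vnorm f.

(* In both products [Ff] stands for the Fourier transform of [f]. *)
Definition UP_lambda (f Ff : G -> C) : \bar R := (V_lambda f * V_lambda Ff)%E.
Definition UP_G (f Ff : G -> C) : \bar R := (V_G f * V_G Ff)%E.

End UncertaintyProducts.

(* Main.v *)
(* If x has first nonzero digit in position N, then p^(-N-1) <= lambda x <=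
   p^(-N) = |x|, with equality on the right only when all digits from N on are
   p-1, hence only on a countable (null) set.  This gives p^-2 V_G <= V_lambda
   <= V_G.  For strictness, V_G f is attained at some a, so that V_lambda f <
   V_G f by comparing the two integrals at a; and both V_G f and V_G (F f) are
   positive.  The latter requires F f <> 0.  Instead of Plancherel's equality
   we use only that the integral of u over a ball is an integral of F u against
   a character over the dual ball (Fubini and orthogonality of characters): if
   F u_n -> 0 and u_n -> f in L_2, all ball integrals of f vanish, so f = 0. *)
From HB Require Import structures.
Require Import Defs.
From mathcomp Require Import all_boot all_order all_algebra.
From mathcomp Require Import complex zify ring lra.
From mathcomp Require Import all_classical all_reals all_analysis.
From mathcomp Require Import measurable_realfun.
Set Implicit Arguments.
Unset Strict Implicit.
Unset Printing Implicit Defensive.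
Import Order.TTheory GRing.Theory Num.Theory.
Import numFieldNormedType.Exports.
Local Open Scope classical_set_scope.
Local Open Scope ring_scope.

(** * Digits and balls *)

(** A pointwise strict inequality between the two integrals at every centre does not survive the
    infimum over centres, which is why a true minimizer is needed. Existence of one rests on the
    ultrametric inequality in the form |x-z|^2 <= |x-y|^2 + |y-z|^2: integrated against |f|^2, it
    makes the dispersion integral both uniformly continuous and coercive in its centre. Positivity
    of the two variances has a second use: it excludes products of 0 and +oo, so that a finite
    [UP_G] forces both factors to be finite, and the two strict inequalities can be multiplied. When
    [UP_G] is infinite, the first inequality makes [UP_lambda] infinite as well, so strictness is
    claimed for finite [UP_G]. The transform [Ff] is known only as an L_2 limit of transforms of L_1
    functions, so its nonvanishing has to be read off from the approximants. Integrals are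
    real-valued, hence the Fourier part works with real and imaginary parts, and the imaginary part
    of f is reduced to the real one by passing from u to -i u. *)

Section Digits.
Variable p : nat.
Local Notation G := (vilenkin p).

Lemma vilenkinP (x y : G) : (forall j, x j = y j) -> x = y.
Proof. by move=> xy; apply/val_inj/funext. Qed.

Lemma digit0 j : (0 : G) j = 0. Proof. by []. Qed.
Lemma digitD (x y : G) j : (x + y) j = x j + y j. Proof. by []. Qed.
Lemma digitN (x : G) j : (- x) j = - x j. Proof. by []. Qed.
Lemma digitB (x y : G) j : (x - y) j = x j - y j. Proof. by []. Qed.

Lemma digit_eq0 (x : G) : exists n : int, forall j, j < n -> x j = 0.
Proof. by have /asboolP := digit_left_finite x. Qed.

Lemma vseq_left_finite (n : int) (d : int -> 'Z_p) :
  (fun j => if j < n then 0 else d j) \in @left_finite p.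
Proof. by apply/asboolP; exists n => j ->. Qed.

Definition vseq (n : int) (d : int -> 'Z_p) : G :=
  Vilenkin (vseq_left_finite n d).

Lemma vseqE n d j : vseq n d j = if j < n then 0 else d j. Proof. by []. Qed.

Definition vball (a : G) (n : int) : set G :=
  [set x | forall j, j < n -> x j = a j].

Lemma vball_refl a n : vball a n a. Proof. by []. Qed.

Lemma vball_sym a b n : vball a n b -> vball b n a.
Proof. by move=> ab j jn; rewrite ab. Qed.

Lemma vball_trans a b c n : vball a n b -> vball b n c -> vball a n c.
Proof. by move=> ab bc j jn; rewrite bc// ab. Qed.

Lemma vball_eq a b n : vball a n b -> vball a n = vball b n.
Proof.
move=> ab; apply/seteqP; split=> x; last exact: vball_trans.
by move: (vball_sym ab); exact: vball_trans.
Qed.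

Lemma vball_le a m n : m <= n -> vball a n `<=` vball a m.
Proof. by move=> mn x xa j jm; rewrite xa// (lt_le_trans jm). Qed.

Lemma vballB a n x : vball a n x <-> vball 0 n (x - a).
Proof.
split=> h j jn; first by rewrite digitB h// subrr.
by have := h j jn; rewrite digitB digit0 => /eqP; rewrite subr_eq0 => /eqP.
Qed.

Lemma vball_exists (x : G) : exists k : nat, vball 0 (- k%:Z) x.
Proof.
have [n xn] := digit_eq0 x; exists `|n|%N => j jn.
by rewrite xn//; lia.
Qed.

Lemma vball_translate a n : vball a n = [set a + x | x in vball 0 n].
Proof.
apply/seteqP; split=> [x /vballB xa|_ [x x0 <-]].
  by exists (x - a) => //; rewrite addrC subrK.
by apply/vballB; rewrite [a + x]addrC addrK.
Qed.

Lemma vball_open a n : open (vball a n).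
Proof.
move=> x xa; exists n => y yx j jn.
by rewrite yx// xa.
Qed.

Lemma vopenE (A : set G) : open A <-> vopen A.
Proof. by []. Qed.

Lemma open_measurable_vilenkin (A : set G) : open A -> measurable A.
Proof. by move=> oA; exact: sub_sigma_algebra. Qed.

Lemma vball_measurable a n : measurable (vball a n).
Proof. by apply: open_measurable_vilenkin; exact: vball_open. Qed.

Lemma digit_indexP (x : G) : x != 0 ->
  x (digit_index x) != 0 /\ forall j, j < digit_index x -> x j = 0.
Proof.
move=> x0.
suff: exists n : int, x n != 0 /\ forall j : int, j < n -> x j = 0.
  exact: (@xgetPex _ 0
    [set n : int | x n != 0 /\ forall j : int, j < n -> x j = 0]).
have [m xm] := digit_eq0 x.
(* All digits below [m] vanish, so the first nonzero position is a minimum over natural offsets from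
   [m]. *)
have exk : exists k : nat, x (m + k%:Z) != 0.
  apply: contrapT => /forallNP h; move/eqP: x0; apply.
  apply/vilenkinP => j; have [/xm//|mj] := ltP j m.
  apply/eqP/negPn/negP; have := h `|j - m|%N.
  by rewrite (_ : m + _ = j); last lia.
case: (ex_minnP exk) => k xk kmin; exists (m + k%:Z); split=> // j jk.
have [/xm//|mj] := ltP j m.
apply/eqP; apply: contraTT jk => xj; rewrite -leNgt.
have : x (m + `|j - m|%N%:Z) != 0 by rewrite (_ : m + _ = j); last lia.
by move=> /kmin; lia.
Qed.

Lemma measurable_fun_vilenkin (R : realType) (F : G -> R) :
  (forall x (e : R), 0 < e ->
    exists n, forall y, vball x n y -> `|F y - F x| < e) ->
  measurable_fun [set: G] F.
Proof.
move=> cF; apply: (measurability _ (RGenOpens.measurableE R)).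
move=> _ [_ [a [b ->]] <-]; rewrite setTI.
apply: open_measurable_vilenkin; apply/vopenE => x /=.
rewrite in_itv/= => /andP[ax xb].
have e0 : 0 < Num.min (F x - a) (b - F x) by rewrite lt_min !subr_gt0 ax.
have [n hn] := cF x _ e0.
exists n => y /hn; rewrite in_itv/= lt_min => /andP[].
by rewrite !ltr_norml => /andP[h1 h2] /andP[h3 h4]; apply/andP; split; lra.
Qed.

Lemma measurable_locally_constant d (T : measurableType d) (F : G -> T) n :
  (forall x y, vball x n y -> F y = F x) -> measurable_fun [set: G] F.
Proof.
move=> cF _ B mB; rewrite setTI; apply: open_measurable_vilenkin.
apply/vopenE => x xB; exists n => y /cF; rewrite /preimage/= => ->; exact: xB.
Qed.

End Digits.

(** * The norm and the map lambda *)

Section NormLambda.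
Variables (R : realType) (p : nat).
Hypothesis hp : (1 < p)%N.
Local Notation G := (vilenkin p).
Local Notation w n := ((p%:R : R) ^ (- n)).

Lemma p_gt1 : 1 < p%:R :> R. Proof. by rewrite ltr1n. Qed.
Lemma p_gt0 : 0 < p%:R :> R. Proof. by rewrite ltr0n; lia. Qed.
Lemma p_neq0 : p%:R != 0 :> R. Proof. by rewrite gt_eqF// p_gt0. Qed.

Lemma radius_gt0 n : 0 < w n. Proof. by apply: exprz_gt0; exact: p_gt0. Qed.

Lemma radius_le m n : (w m <= w n) = (n <= m).
Proof. by rewrite (ler_eXz2l p_gt1) lerN2. Qed.

Lemma radiusS n : w (n + 1) = w n / p%:R.
Proof. by rewrite opprD expfzDr ?p_neq0. Qed.

Lemma radius_small (e : R) : 0 < e -> exists n : nat, w n%:Z < e.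
Proof.
move=> e0; pose k := Num.Def.archi_bound e^-1; exists k.
have ke : e^-1 < k%:R by rewrite archi_boundP// invr_ge0 ltW.
rewrite -exprnN -[e]invrK ltf_pV2 ?posrE ?exprn_gt0 ?p_gt0 ?invr_gt0//.
by rewrite (lt_trans ke)// -natrX ltr_nat ltn_expl.
Qed.

Lemma digit_lt (x : G) j : (x j < p)%N.
Proof. by have := ltn_ord (x j); rewrite [X in (_ < X)%N](Zp_cast hp). Qed.

Lemma vnorm0 : vnorm R (0 : G) = 0.
Proof. by rewrite /vnorm eqxx. Qed.

Lemma vnormE (x : G) : x != 0 -> vnorm R x = w (digit_index x).
Proof. by rewrite /vnorm => /negbTE ->. Qed.

Lemma vnorm_gt0 (x : G) : x != 0 -> 0 < vnorm R x.
Proof. by move=> x0; rewrite vnormE// radius_gt0. Qed.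

Lemma vnorm_ge0 (x : G) : 0 <= vnorm R x.
Proof. by have [->|/vnorm_gt0/ltW//] := eqVneq x 0; rewrite vnorm0. Qed.

(** For nonzero [x] both sides mean that [digit_index x] is at least [n]. This is the dictionary
    between norm estimates and digits. *)
Lemma vnorm_le_radius (x : G) n : (vnorm R x <= w n) <-> vball 0 n x.
Proof.
have [->|x0] := eqVneq x 0.
  by split=> // _; rewrite vnorm0 ltW// radius_gt0.
have [xN xlt] := digit_indexP x0; rewrite vnormE// radius_le; split.
  by move=> nN j jn; rewrite xlt// (lt_le_trans jn).
by move=> x0n; rewrite leNgt; apply/negP => /x0n xN0; rewrite xN0 eqxx in xN.
Qed.

Lemma vnormN (x : G) : vnorm R (- x) = vnorm R x.
Proof.
have aux (y : G) : vnorm R (- y) <= vnorm R y.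
  have [->|y0] := eqVneq y 0; first by rewrite oppr0.
  rewrite (vnormE y0); apply/vnorm_le_radius => j jy.
  by rewrite digitN (digit_indexP y0).2 ?oppr0.
by apply/eqP; rewrite eq_le aux/= -{1}[x]opprK aux.
Qed.

Lemma vnormBC (x y : G) : vnorm R (x - y) = vnorm R (y - x).
Proof. by rewrite -vnormN opprB. Qed.

Lemma vnormD (x y : G) : vnorm R (x + y) <= Num.max (vnorm R x) (vnorm R y).
Proof.
have [->|x0] := eqVneq x 0; first by rewrite add0r vnorm0 le_max lexx orbT.
have [->|y0] := eqVneq y 0; first by rewrite addr0 le_max lexx.
wlog xy : x y x0 y0 / digit_index x <= digit_index y.
  move=> h; have [xy|/ltW yx] := leP (digit_index x) (digit_index y).
    exact: h.
  by rewrite addrC maxC; exact: h.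
rewrite le_max {1}(vnormE x0); apply/orP; left; apply/vnorm_le_radius => j jx.
rewrite digitD (digit_indexP x0).2// (digit_indexP y0).2 ?addr0//.
exact: lt_le_trans xy.
Qed.

(** By the ultrametric inequality the left side is at most the larger of the two squares, so no
    factor 2 appears, unlike for an ordinary norm. *)
Lemma vnorm_sqB (x y z : G) :
  vnorm R (x - z) ^+ 2 <= vnorm R (x - y) ^+ 2 + vnorm R (y - z) ^+ 2.
Proof.
have := vnormD (x - y) (y - z); rewrite addrA subrK le_max.
by case/orP => h; [apply: ler_wpDr|apply: ler_wpDl];
  rewrite ?sqr_ge0// lerXn2r ?nnegrE ?vnorm_ge0.
Qed.

Lemma vnorm_lipschitz (x y : G) n :
  vball x n y -> vnorm R y <= vnorm R x + w n.
Proof.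
move=> /vballB/vnorm_le_radius yx; have := vnormD x (y - x).
rewrite [x + _]addrC subrK => /le_trans; apply; rewrite ge_max.
by rewrite lerDl (ltW (radius_gt0 n))/= (le_trans yx)// lerDr vnorm_ge0.
Qed.

(** The one-sided bound suffices because [vball x n y] is symmetric in [x] and [y]. It serves both
    [vnorm] and [lambda]. *)
Lemma measurable_of_lipschitz (F : G -> R) :
  (forall x y n, vball x n y -> F y <= F x + w n) -> measurable_fun [set: G] F.
Proof.
move=> hF; apply: measurable_fun_vilenkin => x e e0.
have [n ne] := radius_small e0; exists n%:Z => y xy.
have := hF _ _ _ xy; have := hF _ _ _ (vball_sym xy).
by move=> h1 h2; rewrite ltr_norml; apply/andP; split; lra.
Qed.

Lemma measurable_vnorm : measurable_fun [set: G] (@vnorm R p).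
Proof. by apply: measurable_of_lipschitz => x y n; exact: vnorm_lipschitz. Qed.

(** Comparison with the geometric series of digits p-1. The digits are natural numbers, so that
    truncated or incremented expansions can be plugged in without building an element of [G]. *)
Lemma esum_digits_le (d : int -> nat) (n : int) :
  (forall j, d j < p)%N -> (forall j, j < n -> d j = 0%N) ->
  (\esum_(j in [set: int]) ((d j)%:R * p%:R ^ (- j - 1) : R)%:E <= (w n)%:E)%E.
Proof.
move=> dp d0.
pose t (j : int) : \bar R := ((p%:R - 1) * p%:R ^ (- j - 1))%:E.
have t0 j : (0 <= t j)%E.
  by rewrite lee_fin mulr_ge0 ?subr_ge0 ?(ltW p_gt1)// ltW// exprz_gt0// p_gt0.
apply: (@le_trans _ _ (\esum_(j in [set j : int | (n <= j)%R]) t j)).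
  rewrite [leRHS]esum_mkcond; apply: le_esum => j _.
  have [nj|jn] := leP n j; last first.
    by rewrite d0// mul0r memNset// => /=; apply/negP; rewrite -ltNge.
  rewrite mem_set//.
  rewrite lee_fin ler_wpM2r ?(ltW (exprz_gt0 _ p_gt0))//.
  by rewrite lerBrDr natr1 ler_nat.
rewrite (reindex_esum [set: nat] _ (fun k => n + k%:Z)); last first.
  split=> [k _ /=|k l _ _ /addrI[]//|j /= nj].
    by rewrite lerDl.
  by exists `|j - n|%N => //; lia.
rewrite -nneseries_esumT//.
apply: lime_le; first exact: is_cvg_nneseries.
apply: nearW => K; rewrite sumEFin lee_fin.
(* The sum telescopes: its [k]-th term is [w (n + k) - w (n + k + 1)]. *)
suff -> : \sum_(0 <= k < K) ((p%:R - 1) * p%:R ^ (- (n + k%:Z) - 1)) =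
    w n - w (n + K%:Z) by rewrite gerBl ltW ?radius_gt0.
elim: K => [|K IH]; first by rewrite big_geq// addr0 subrr.
rewrite big_nat_recr//= IH -addn1 PoszD addrA.
rewrite -opprD radiusS.
by field; exact: p_neq0.
Qed.

Local Notation lterm x :=
  (fun j : int => ((x j : nat)%:R * p%:R ^ (- j - 1) : R)%:E).

Lemma lterm_ge0 (x : G) j : (0 <= lterm x j)%E.
Proof. by rewrite lee_fin mulr_ge0// ltW// exprz_gt0// p_gt0. Qed.

Lemma esum_lambda (x : G) :
  (\esum_(j in [set: int]) lterm x j)%E = (lambda R x)%:E.
Proof.
rewrite /lambda fineK// ge0_fin_numE; last first.
  by apply: esum_ge0 => j _; exact: lterm_ge0.
have [n xn] := digit_eq0 x.
apply: le_lt_trans (ltry (w n)).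
by apply: esum_digits_le => j; [exact: digit_lt|move/xn->].
Qed.

Lemma lambda_le_radius (x : G) n : vball 0 n x -> lambda R x <= w n.
Proof.
move=> x0; rewrite -lee_fin -esum_lambda.
by apply: esum_digits_le => j; [exact: digit_lt|move/x0->].
Qed.

Lemma lambda_ge_digit (x : G) j : x j != 0 -> w (j + 1) <= lambda R x.
Proof.
move=> xj; rewrite -lee_fin -esum_lambda; apply: esum_ge.
exists [set j]; first by split.
rewrite fsbig_set1 lee_fin opprD ler_peMl// ?(ltW (exprz_gt0 _ p_gt0))//.
by rewrite ler1n lt0n; apply: contra xj => /eqP xj; apply/eqP/val_inj.
Qed.

Lemma lambda_ge0 (x : G) : 0 <= lambda R x.
Proof.
by rewrite -lee_fin -esum_lambda; apply: esum_ge0 => j _; exact: lterm_ge0.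
Qed.

Lemma lambda_le_vnorm (x : G) : lambda R x <= vnorm R x.
Proof.
have [->|x0] := eqVneq x 0; last first.
  rewrite (vnormE x0); apply: lambda_le_radius => j.
  exact: (digit_indexP x0).2.
rewrite vnorm0 -lee_fin -esum_lambda esum1// => j _.
by rewrite digit0 mul0r.
Qed.

Lemma vnorm_le_lambda (x : G) : vnorm R x / p%:R <= lambda R x.
Proof.
have [->|x0] := eqVneq x 0; first by rewrite vnorm0 mul0r lambda_ge0.
by rewrite (vnormE x0) -radiusS lambda_ge_digit// (digit_indexP x0).1.
Qed.

Lemma lambda_lipschitz (x y : G) n :
  vball x n y -> lambda R y <= lambda R x + w n.
Proof.
move=> yx; rewrite -lee_fin EFinD -!esum_lambda.
(* Below [n] the digits of [y] are those of [x]; the rest of [y] is the tail [d], whose series is at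
   most [w n]. *)
pose d j := if j < n then 0%N else y j : nat.
apply: (@le_trans _ _ (\esum_(j in [set: int])
    (lterm x j + ((d j)%:R * p%:R ^ (- j - 1) : R)%:E))%E).
  apply: le_esum => j _; rewrite -EFinD lee_fin -mulrDl.
  rewrite ler_wpM2r ?(ltW (exprz_gt0 _ p_gt0))// /d.
  have [jn|nj] := ltP j n; first by rewrite addr0 yx.
  by rewrite lerDr.
rewrite esumD; last 2 first.
- by move=> j _; exact: lterm_ge0.
- by move=> j _; rewrite lee_fin mulr_ge0// ltW// exprz_gt0// p_gt0.
rewrite leeD2l//; apply: esum_digits_le => j; rewrite /d; last by move->.
by case: ifP => _; [lia|exact: digit_lt].
Qed.

Lemma measurable_lambda : measurable_fun [set: G] (@lambda R p).
Proof. by apply: measurable_of_lipschitz => x y n; exact: lambda_lipschitz. Qed.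

(* A digit below the maximum after the leading one leaves room for one more
   unit in that position. *)
Lemma lambda_lt_vnorm (x : G) j : x != 0 -> digit_index x <= j ->
  (x j : nat) != p.-1 -> lambda R x < vnorm R x.
Proof.
move=> x0 xj xjp; rewrite (vnormE x0).
pose d i := ((x i : nat) + (i == j))%N.
have h : (\esum_(i in [set: int]) ((d i)%:R * p%:R ^ (- i - 1) : R)%:E <=
    (w (digit_index x))%:E)%E.
  apply: esum_digits_le => i; rewrite /d.
    by have := digit_lt x i; case: eqP => [->|_]; [lia|rewrite addn0].
  move=> ix; rewrite (digit_indexP x0).2// (_ : i == j = false)//.
  by apply/negbTE; rewrite lt_eqF// (lt_le_trans ix).
rewrite -lte_fin; apply: lt_le_trans h.
under eq_esum do rewrite natrD mulrDl EFinD.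
rewrite esumD; last 2 first.
- by move=> i _; exact: lterm_ge0.
- by move=> i _; rewrite lee_fin mulr_ge0// ltW// exprz_gt0// p_gt0.
rewrite esum_lambda lteDl//.
apply: (@lt_le_trans _ _ (w (j + 1))%:E); first by rewrite lte_fin radius_gt0.
apply: esum_ge; exists [set j]; first by split.
by rewrite fsbig_set1 eqxx mul1r opprD.
Qed.

Lemma countable_lambda_eq_vnorm :
  countable [set x : G | lambda R x = vnorm R x].
Proof.
(* The exceptional points: [None] stands for 0, and [Some n] for the sequence whose digits are all
   p-1 from position [n] on. *)
pose s (o : option int) : G :=
  if o is Some n then vseq n (fun=> inZp p.-1) else 0.
apply: (@sub_countable _ _ _ (range s)); last first.
  by apply: (sub_countable (card_image_le _ _)); exact: countableP.
apply: subset_card_le => x /= lx.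
have [->|x0] := eqVneq x 0; first by exists None.
exists (Some (digit_index x)) => //; apply/vilenkinP => j; rewrite vseqE.
have [jx|xj] := ltP j (digit_index x); first by rewrite (digit_indexP x0).2.
apply/val_inj => /=; rewrite modn_small; last by rewrite (Zp_cast hp); lia.
apply/esym/eqP/negPn/negP => xjp; have := lambda_lt_vnorm x0 xj xjp.
by rewrite lx ltxx.
Qed.

End NormLambda.

(** * Haar measure *)

Section Translation.
Variable p : nat.
Local Notation G := (vilenkin p).

Lemma measurable_translation (a : G) : measurable_fun [set: G] (fun x => a + x).
Proof.
apply: (@measurability _ _ _ _ _ _ (@open G)) => // _ [A oA <-]; rewrite setTI.
apply: open_measurable_vilenkin; apply/vopenE => x /oA[n An].
exists n => y xy; apply: An => j jn.
by rewrite !digitD xy.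
Qed.

End Translation.

Section Haar.
Variables (R : realType) (p : nat).
Hypothesis hp : (1 < p)%N.
Local Notation G := (vilenkin p).
Local Notation w n := ((p%:R : R) ^ (- n)).
Variable mu : {measure set G -> \bar R}.
Hypothesis hmu : haar_measure mu.

Lemma haar_vball (a : G) n : mu (vball a n) = mu (vball 0 n).
Proof.
by case: hmu => tr _ _; rewrite vball_translate tr//; exact: vball_measurable.
Qed.

Lemma haar_vballS (n : int) :
  mu (vball 0 n) = (p%:R%:E * mu (vball 0%R (n + 1)%R))%E.
Proof.
(* The ball splits into [p] disjoint translates of the next smaller one, according to the digit in
   position [n]. *)
pose e (k : nat) : G := vseq n (fun j => if j == n then inZp k else 0).
have -> : vball (0 : G) n = \bigcup_(k in `I_p) vball (e k) (n + 1).
  apply/seteqP; split=> [x xn|x [k /= kp xk] j jn]; last first.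
    by rewrite xk ?vseqE ?jn// (lt_trans jn)// ltrDl.
  exists (x n : nat); first exact: digit_lt.
  move=> j jn; rewrite vseqE; case: ifPn => [/xn//|nj].
  have -> : j = n by lia.
  by rewrite eqxx; apply/val_inj; rewrite /= modn_small.
rewrite measure_fin_bigcup//.
- rewrite -fsbig_ord (eq_bigr (fun=> mu (vball 0 (n + 1)))).
    by rewrite mule_natl sumr_const card_ord.
  by move=> k _; exact: haar_vball.
- move=> k l /= kp lp [x [/(_ n) xk /(_ n) xl]].
  move: xk xl; rewrite ltrDl ltr01 => /(_ isT) -> /(_ isT).
  rewrite !vseqE ltxx eqxx => /(congr1 val) /=.
  by rewrite (Zp_cast hp) !modn_small.
- by move=> k _; exact: vball_measurable.
Qed.

(** The normalization fixes the case [n = 0]; [mP] divides by [p] to go up through the positive [n],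
    and [mS] multiplies by [p] to go down. *)
Lemma haar_vballE (a : G) n : mu (vball a n) = (w n)%:E.
Proof.
rewrite haar_vball; have p0 := p_neq0 R hp.
have mS m r : mu (vball 0 (m + 1)) = r%:E -> mu (vball 0 m) = (p%:R * r)%:E.
  by rewrite (haar_vballS m) EFinM => ->.
have mP m r : mu (vball 0 m) = r%:E -> mu (vball 0 (m + 1)) = (r / p%:R)%:E.
  rewrite (haar_vballS m) => h.
  by rewrite [(r / _)%R]mulrC EFinM -h muleA -EFinM mulVf// mul1e.
have m0 : mu (vball 0 0) = 1%:E by case: hmu => _ _ <-.
case: n => k.
  elim: k => [|k IH]; first by rewrite m0 oppr0.
  by rewrite -addn1 PoszD (mP _ _ IH) (radiusS R hp).
rewrite NegzE; elim: k => [|k IH].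
  have := mS (-1) 1; rewrite addNr => /(_ m0) ->.
  by rewrite opprK mulr1.
rewrite (mS _ (p%:R ^ (k.+1 : int))).
  by rewrite -exprSz opprK.
by rewrite (_ : _ + 1 = - (k.+1 : int)); [rewrite IH opprK|lia].
Qed.

Lemma haar_vball_lty (a : G) n : (mu (vball a n) < +oo)%E.
Proof. by rewrite haar_vballE ltry. Qed.

Lemma measurable_vset1 (a : G) : measurable [set a].
Proof.
have -> : [set a] = \bigcap_(n : nat) vball a n%:Z.
  apply/seteqP; split=> [_ -> n _//|x xa /=].
  by apply/vilenkinP => j; apply: (xa `|j|%N.+1) => //; lia.
by apply: bigcapT_measurable => n; exact: vball_measurable.
Qed.

Lemma haar_set1 (a : G) : mu [set a] = 0%E.
Proof.
apply/eqP; rewrite eq_le measure_ge0 andbT.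
apply/lee_addgt0Pr => e e0; rewrite add0e.
have [n ne] := radius_small hp e0.
apply: (@le_trans _ _ (mu (vball a n%:Z))).
  apply: le_measure; rewrite ?inE.
  - exact: measurable_vset1.
  - exact: vball_measurable.
  - by move=> _ ->.
by rewrite haar_vballE lee_fin ltW.
Qed.

Lemma haar_countable (A : set G) : countable A -> mu.-negligible A.
Proof.
move=> /pfcard_geP[->|[f]]; first exact: negligible_set0.
apply: (@negligibleS _ _ _ _ (\bigcup_k [set f k])).
  move=> x Ax; have [k _ fk] := @surj _ _ _ _ f _ Ax.
  by exists k.
apply: negligible_bigcup => k; exists [set f k]; split=> //.
  exact: measurable_vset1.
exact: haar_set1.
Qed.

Lemma vball_bigcupT : \bigcup_(k : nat) vball (0 : G) (- k%:Z) = setT.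
Proof.
by apply/seteqP; split=> // x _; have [k xk] := vball_exists x; exists k.
Qed.

Lemma haar_sigma_finite : sigma_finite [set: G] mu.
Proof.
exists (fun k : nat => vball 0 (- k%:Z)); first by rewrite vball_bigcupT.
by move=> k; split; [exact: vball_measurable|exact: haar_vball_lty].
Qed.

Lemma haar_pushforward (a : G) (A : set G) : measurable A ->
  pushforward mu (fun x : G => a + x) A = mu A.
Proof.
move=> mA; case: hmu => tr _ _; rewrite /pushforward -(tr (- a) A mA).
congr (mu _); apply/seteqP; split=> [x /= Ax|_ [x Ax <-] /=].
  by exists (a + x) => //; rewrite addKr.
by rewrite addNKr.
Qed.

Lemma integral_translation (a : G) (h : G -> \bar R) :
  mu.-integrable setT h ->
  (\int[mu]_x h (a + x)%R = \int[mu]_x h x)%E.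
Proof.
move=> ih; have mh := measurable_int _ ih.
have ma := measurable_translation a.
(* The change of variables is made for nonnegative functions, then applied to the positive and
   negative parts of [h]. *)
have key (g : G -> \bar R) :
    measurable_fun [set: G] g -> (forall x, 0 <= g x)%E ->
    (\int[mu]_x g (a + x)%R = \int[mu]_x g x)%E.
  move=> mg g0.
  transitivity (\int[pushforward mu (fun x : G => (a + x)%R)]_x g x)%E.
    by rewrite [RHS]ge0_integral_pushforward.
  by apply: eq_measure_integral => A mA _; exact: haar_pushforward.
rewrite integralE [RHS]integralE; congr (_ - _)%E.
  rewrite -(key h^\+%E) => [|//|x]; last exact: funepos_ge0.
    by apply: eq_integral => x _; rewrite !funeposE.
  exact: measurable_funepos.
rewrite -(key h^\-%E) => [|//|x]; last exact: funeneg_ge0.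
  by apply: eq_integral => x _; rewrite !funenegE.
exact: measurable_funeneg.
Qed.

End Haar.

(** * Minimal dispersion *)

(* The infimum is attained by descending through nested balls, each of which
   still competes with every point; this replaces compactness of balls. *)
Section Minimum.
Variables (R : realType) (p : nat).
Hypothesis hp : (1 < p)%N.
Local Notation G := (vilenkin p).
Variables (I : G -> \bar R) (b0 : G) (n0 : int).
Hypothesis I_unif : forall e : R, 0 < e -> exists k : nat,
  forall a b, vball a (n0 + k%:Z) b -> (I a <= I b + e%:E)%E.
Hypothesis I_coercive : forall b, (I b <= I b0)%E -> vball b0 n0 b.

Let minimizing c n := forall b, exists2 b', vball c n b' & (I b' <= I b)%E.

(* Pigeonhole over the [p] sub-balls, one for each value of the digit [n]. *)
Let minimizing_subball c n : minimizing c n ->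
  exists2 c', vball c n c' & minimizing c' (n + 1).
Proof.
move=> cn; apply: contrapT => h.
pose s (d : 'Z_p) : G := c + vseq n (fun j => if j == n then d - c j else 0).
have sc d : vball c n (s d).
  by move=> j jn; rewrite digitD vseqE jn addr0.
have sn d : s d n = d.
  by rewrite digitD vseqE ltxx eqxx addrC subrK.
(* If no sub-ball is minimizing, each one has a challenger [b d] strictly better than all of its
   points; [d0] picks the best of these [p] challengers. *)
have /choice[b hb] d : exists b, forall b', vball (s d) (n + 1) b' ->
    (I b < I b')%E.
  apply: contrapT => /forallNP hd; apply: h; exists (s d) => // b.
  have /existsNP[b' /not_implyP[sb' /negP]] := hd b.
  by rewrite -leNgt => ?; exists b'.
pose d0 := [arg min_(d < (0 : 'Z_p)) I (b d)]%O.
have hd0 d : (I (b d0) <= I (b d))%E.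
  by rewrite /d0; case: Order.TotalTheory.arg_minP => // i _; exact.
have [b' cb' b'd0] := cn (b d0).
(* [b'] lies in the sub-ball of its own digit [b' n], so it loses to the challenger of that sub-ball
   and hence to [b d0], although it was chosen at least as good as [b d0]. *)
have : (I (b (b' n)) < I b')%E.
  apply: hb => j jn; have [jn'|nj] := ltP j n.
    by rewrite (cb' _ jn') (sc _ _ jn').
  by rewrite (_ : j = n) ?sn//; lia.
by rewrite ltNge (le_trans b'd0).
Qed.

Lemma min_attained : exists a, forall b, (I a <= I b)%E.
Proof.
have minn0 : minimizing b0 n0.
  move=> b; have [bb0|b0b] := leP (I b) (I b0).
    by exists b => //; exact: I_coercive.
  by exists b0; [exact: vball_refl|exact: ltW].
(* [F] is total, with the junk value 0 off the minimizing balls, so that the centres can be defined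
   by plain recursion before [minimizing] is proved for them. *)
have /choice[F hF] (ck : G * nat) : exists c',
    minimizing ck.1 (n0 + ck.2%:Z) ->
    vball ck.1 (n0 + ck.2%:Z) c' /\ minimizing c' (n0 + ck.2.+1%:Z).
  have [/minimizing_subball[c' h1 h2]|h] :=
      pselect (minimizing ck.1 (n0 + ck.2%:Z)); last by exists 0.
  by exists c' => _; split=> //; rewrite -addn1 PoszD addrA.
pose s := fix s k := if k is k'.+1 then F (s k', k') else b0.
have smin k : minimizing (s k) (n0 + k%:Z).
  elim: k => [|k IH]; first by rewrite addr0.
  exact: (hF (s k, k) IH).2.
have sS k : vball (s k) (n0 + k%:Z) (s k.+1).
  exact: (hF (s k, k) (smin k)).1.
have sD k l : vball (s k) (n0 + k%:Z) (s (k + l)%N).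
  elim: l => [|l IH]; first by rewrite addn0; exact: vball_refl.
  apply: (vball_trans IH); rewrite addnS.
  by apply: vball_le (sS _); rewrite PoszD; lia.
have [m sm] := digit_eq0 b0.
(* Diagonal limit of the centres: digit [j] no longer changes from stage |j - n0| + 1 on, and below
   [n0] all centres agree with [b0]. The cut at [Num.min m n0] makes the sequence left finite and
   loses nothing, since [b0] vanishes below [m]. *)
pose a : G := vseq (Num.min m n0) (fun j => s `|j - n0|%N.+1 j).
have sa k : vball (s k) (n0 + k%:Z) a.
  move=> j jk; rewrite vseqE; have [jn|nj] := ltP j n0.
    have := sD 0%N k j; rewrite add0n addr0 => /(_ jn) ->.
    case: ifPn => [jm|]; first by rewrite sm//; lia.
    by move=> _; have := sD 0%N `|j - n0|%N.+1 j; rewrite add0n addr0; exact.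
  case: ifPn => [|_]; first lia.
  have -> : k = (`|j - n0|%N.+1 + (k - `|j - n0|%N.+1))%N by lia.
  by apply/esym/sD; lia.
exists a => b; apply/lee_addgt0Pr => e e0.
have [k Ik] := I_unif e0.
have [b' sb' b'b] := smin k b.
apply: le_trans (Ik _ _ (vball_trans (vball_sym (sa k)) sb')) _.
by rewrite leeD2r.
Qed.

End Minimum.

(** * Dispersion integrals against a nonnegative weight *)

Section Dispersion.
Variables (R : realType) (p : nat).
Hypothesis hp : (1 < p)%N.
Local Notation G := (vilenkin p).
Local Notation w n := ((p%:R : R) ^ (- n)).
Variable mu : {measure set G -> \bar R}.
Hypothesis hmu : haar_measure mu.

Lemma measurable_fun_subr (h : G -> R) (a : G) :
  measurable_fun [set: G] h -> measurable_fun [set: G] (fun x => h (x - a)).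
Proof.
move=> mh; under eq_fun do rewrite addrC.
exact: (measurableT_comp mh (measurable_translation (- a))).
Qed.

Section Weight.
Variable g : G -> R.
Hypothesis mg : measurable_fun [set: G] g.
Hypothesis g0 : forall x, 0 <= g x.
Hypothesis gne0 : ~ {ae mu, forall x, g x = 0}.

(** A zero integral would force [h x * g x = 0] almost everywhere, hence [g = 0] almost everywhere.
    It is applied with [h] equal to 1, to a squared norm, and to the gap between the squares of
    [vnorm] and [lambda]. *)
Lemma integral_weight_gt0 (h : G -> R) : measurable_fun [set: G] h ->
  (forall x, 0 <= h x) -> mu.-negligible [set x | h x = 0] ->
  (0 < \int[mu]_x (h x * g x)%:E)%E.
Proof.
move=> mh h0 hnull; rewrite lt0e integral_ge0 ?andbT; last first.
  by move=> x _; rewrite lee_fin mulr_ge0.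
apply/eqP => int0; apply: gne0.
have mhg : measurable_fun [set: G] (fun x => (h x * g x)%:E).
  by apply/measurable_EFinP; exact: measurable_funM.
have : (\int[mu]_x `|(h x * g x)%:E| = 0)%E.
  rewrite -[RHS]int0; apply: eq_integral => x _.
  by rewrite gee0_abs// lee_fin mulr_ge0.
move=> /(ae_eq_integral_abs _ measurableT mhg) hg0.
have hne0 : {ae mu, forall x, h x != 0}.
  apply: negligibleS hnull => x /= /negP; rewrite negbK => /eqP//.
apply: filterS2 hg0 hne0 => x /(_ Logic.I) [] /eqP; rewrite mulf_eq0.
by case/orP=> [->//|/eqP].
Qed.

Let dispersion (rho : G -> R) (a : G) : \bar R :=
  (\int[mu]_x (rho (x - a)%R ^+ 2 * g x)%:E)%E.

Let measurable_dispersion (rho : G -> R) a : measurable_fun [set: G] rho ->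
  measurable_fun [set: G] (fun x => (rho (x - a) ^+ 2 * g x)%:E).
Proof.
move=> mrho; apply/measurable_EFinP; apply: measurable_funM => //.
by apply: measurable_funX; exact: measurable_fun_subr.
Qed.

Let dispersion_term_ge0 (rho : G -> R) a x :
  (0 <= (rho (x - a)%R ^+ 2 * g x)%:E)%E.
Proof. by rewrite lee_fin mulr_ge0 ?sqr_ge0. Qed.

Lemma dispersion_lambda_le a :
  (dispersion (@lambda R p) a <= dispersion (@vnorm R p) a)%E.
Proof.
apply: ge0_le_integral => // [||x _].
- by apply: measurable_dispersion; exact: measurable_lambda.
- by apply: measurable_dispersion; exact: measurable_vnorm.
- rewrite lee_fin ler_wpM2r// lerXn2r ?nnegrE ?lambda_ge0 ?vnorm_ge0//.
  exact: lambda_le_vnorm.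
Qed.

Lemma dispersion_vnorm_le a :
  ((p%:R ^- 2)%:E * dispersion (@vnorm R p) a <= dispersion (@lambda R p) a)%E.
Proof.
rewrite /dispersion -ge0_integralZl//; last first.
  by apply: measurable_dispersion; exact: measurable_vnorm.
apply: ge0_le_integral => // [x _|||x _].
- by rewrite -EFinM lee_fin mulr_ge0 ?invr_ge0 ?exprn_ge0// mulr_ge0 ?sqr_ge0.
- apply: emeasurable_funM => //.
  by apply: measurable_dispersion; exact: measurable_vnorm.
- by apply: measurable_dispersion; exact: measurable_lambda.
- rewrite -EFinM lee_fin mulrA ler_wpM2r// mulrC -exprVn -exprMn.
  rewrite lerXn2r ?nnegrE ?lambda_ge0 ?mulr_ge0 ?invr_ge0 ?vnorm_ge0//.
  exact: vnorm_le_lambda.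
Qed.

Hypothesis intg : (\int[mu]_x (g x)%:E < +oo)%E.
Let C := fine (\int[mu]_x (g x)%:E).

Let integral_g : (\int[mu]_x (g x)%:E = C%:E)%E.
Proof.
rewrite /C fineK// ge0_fin_numE//; apply: integral_ge0 => x _.
by rewrite lee_fin.
Qed.

Let C_gt0 : 0 < C.
Proof.
rewrite -lte_fin -integral_g; have := @integral_weight_gt0 (fun=> 1).
under eq_integral do rewrite mul1r; apply => //.
rewrite (_ : [set x | _] = set0); first exact: negligible_set0.
by apply/seteqP; split=> // x /= /eqP; rewrite oner_eq0.
Qed.

Let dispersion_tri a b c :
  (forall x, vnorm R (x - a) ^+ 2 <= vnorm R (x - b) ^+ 2 + c) -> 0 <= c ->
  (dispersion (@vnorm R p) a <= dispersion (@vnorm R p) b + (C * c)%:E)%E.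
Proof.
move=> abc c0; rewrite [(C * c)%R]mulrC EFinM -integral_g.
rewrite -ge0_integralZl//; last 2 first.
- exact/measurable_EFinP.
- by move=> x _; rewrite lee_fin.
rewrite -ge0_integralD//; last 3 first.
- by apply: measurable_dispersion; exact: measurable_vnorm.
- by move=> x _; rewrite -EFinM lee_fin mulr_ge0.
- by apply: emeasurable_funM => //; exact/measurable_EFinP.
apply: ge0_le_integral => // [||x _].
- by apply: measurable_dispersion; exact: measurable_vnorm.
- apply: emeasurable_funD.
    by apply: measurable_dispersion; exact: measurable_vnorm.
  by apply: emeasurable_funM => //; exact/measurable_EFinP.
- by rewrite -EFinM -EFinD lee_fin -mulrDl ler_wpM2r.
Qed.

(** Coercivity: [vnorm_sqB] through the running point [x], integrated against [g]. Two centres of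
    small dispersion cannot be far apart. *)
Let dispersion_lb a b :
  ((vnorm R (b - a) ^+ 2 * C)%:E <=
    dispersion (@vnorm R p) a + dispersion (@vnorm R p) b)%E.
Proof.
rewrite EFinM -integral_g -ge0_integralZl//; last 3 first.
- exact/measurable_EFinP.
- by move=> x _; rewrite lee_fin.
- by rewrite lee_fin sqr_ge0.
rewrite -ge0_integralD//; last 2 first.
- by apply: measurable_dispersion; exact: measurable_vnorm.
- by apply: measurable_dispersion; exact: measurable_vnorm.
apply: ge0_le_integral => // [x _|||x _].
- by rewrite -EFinM lee_fin mulr_ge0 ?sqr_ge0.
- by apply: emeasurable_funM => //; exact/measurable_EFinP.
- by apply: emeasurable_funD;
    apply: measurable_dispersion; exact: measurable_vnorm.
- rewrite -EFinM -EFinD lee_fin -mulrDl ler_wpM2r//.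
  by rewrite [leRHS]addrC (vnormBC R hp x b) vnorm_sqB.
Qed.

Lemma dispersion_min_attained :
  exists a, forall b,
    (dispersion (@vnorm R p) a <= dispersion (@vnorm R p) b)%E.
Proof.
have [[b0 b0lt]|h] :=
  pselect (exists b, (dispersion (@vnorm R p) b < +oo)%E); last first.
  (* When every dispersion is infinite, any centre is a minimizer. *)
  move/forallNP : h => h; exists 0 => b; have /negP := h b.
  by rewrite -leNgt leye_eq => /eqP ->; rewrite leey.
have [M b0M] : exists M, dispersion (@vnorm R p) b0 = M%:E.
  exists (fine (dispersion (@vnorm R p) b0)); rewrite fineK// ge0_fin_numE//.
  by apply: integral_ge0 => x _; exact: dispersion_term_ge0.
have M0 : 0 <= M.
  rewrite -lee_fin -b0M; apply: integral_ge0 => x _.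
  exact: dispersion_term_ge0.
(* A centre [b] no worse than [b0] satisfies |b0 - b|^2 C <= 2M by [dispersion_lb]. With K = [w k]
   below this threshold and K <= 1, one gets K^2 (2M + 1) <= C, hence |b0 - b| <= 1/K, the radius of
   the search ball. *)
have r0 : 0 < C / (2 * M + 1) by rewrite divr_gt0//; lra.
have [k hk] := radius_small hp r0.
apply: (@min_attained R p hp (dispersion (@vnorm R p)) b0 (- k%:Z))
  => [e e0|b bb0].
  pose W := w (- k%:Z).
  have W0 : 0 < W by exact: radius_gt0.
  (* Moving the centre by at most [W * w l] costs C (W K)^2 with K = [w l]. The bound 1 replaces K^2
     by K, and the second bound then brings the cost below [e]. *)
  have d0 : 0 < Num.min 1 (e / ((C + 1) * W ^+ 2)).
    by rewrite lt_min ltr01/= divr_gt0// mulr_gt0 ?exprn_gt0// ltr_wpDl// ltW.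
  have [l q] := radius_small hp d0; exists l => a b ab.
  apply: (@le_trans _ _
    (dispersion (@vnorm R p) b + (C * (W * w l%:Z) ^+ 2)%:E)%E).
    apply: dispersion_tri; last exact: sqr_ge0.
    move=> x; apply: le_trans (vnorm_sqB R hp x b a) _.
    rewrite lerD2l lerXn2r ?nnegrE ?vnorm_ge0//.
      by rewrite mulr_ge0// ltW// radius_gt0.
    rewrite /W -expfzDr ?p_neq0// -opprD; apply/vnorm_le_radius => //.
    by move/vballB : ab.
  rewrite leeD2l// lee_fin.
  move: q; rewrite lt_min ltr_pdivlMr; last first.
    by rewrite mulr_gt0 ?exprn_gt0// ltr_wpDl// ltW.
  move=> /andP[K1 Ke]; have K0 := radius_gt0 R hp l%:Z.
  move: K1 Ke K0; set K := w _ => K1 Ke K0.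
  have : C * W ^+ 2 * K * K <= C * W ^+ 2 * K * 1.
    by rewrite ler_wpM2l ?ltW// !mulr_gt0// exprn_gt0.
  have : 0 < K * W ^+ 2 by rewrite mulr_gt0// exprn_gt0.
  by rewrite exprMn; lra.
apply/vballB/(vnorm_le_radius R hp).
have := le_trans (dispersion_lb b0 b) (leeD2l (dispersion (@vnorm R p) b0) bb0).
rewrite b0M -EFinD lee_fin => h.
have K0 := radius_gt0 R hp k%:Z.
have wk : w (- k%:Z) = (w k%:Z)^-1 by rewrite invr_expz.
rewrite wk -(@ler_pXn2r _ 2) ?nnegrE ?vnorm_ge0 ?invr_ge0 ?(ltW K0)//.
rewrite exprVn -[leRHS]mul1r ler_pdivlMr ?exprn_gt0//.
move: hk K0; set K := w _; rewrite ltr_pdivlMr; last by lra.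
set v := vnorm _ _ in h *; move=> hk K0.
have K1 : K <= 1 by rewrite /K -[leRHS](expr0z p%:R) -oppr0 radius_le.
rewrite -(ler_pM2r C_gt0) mul1r.
have v0 : 0 <= v ^+ 2 by exact: sqr_ge0.
have : v ^+ 2 * C * K ^+ 2 <= (M + M) * K ^+ 2 by rewrite ler_wpM2r// sqr_ge0.
have : K * K * (2 * M + 1) <= 1 * C.
  by rewrite -mulrA ler_pM// ?mulr_ge0 ?(ltW K0)//; lra.
have : 0 < K * K by rewrite mulr_gt0.
rewrite !expr2; lra.
Qed.

Let exceptional_negligible a :
  mu.-negligible [set x | vnorm R (x - a) ^+ 2 - lambda R (x - a) ^+ 2 = 0].
Proof.
apply: haar_countable => //.
apply: (@sub_countable _ _ _
  ((fun x => x + a) @` [set x : G | lambda R x = vnorm R x])); last first.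
  apply: (sub_countable (card_image_le _ _)).
  exact: countable_lambda_eq_vnorm.
apply: subset_card_le => x /= /eqP; rewrite subr_eq0 => /eqP h.
exists (x - a); rewrite ?subrK//=; apply/eqP.
by rewrite -(@eqrXn2 _ 2) ?lambda_ge0 ?vnorm_ge0// h.
Qed.

Lemma dispersion_lambda_lt a : (dispersion (@vnorm R p) a < +oo)%E ->
  (dispersion (@lambda R p) a < dispersion (@vnorm R p) a)%E.
Proof.
move=> aoo; have lam0 : (0 <= dispersion (@lambda R p) a)%E.
  by apply: integral_ge0 => x _; exact: dispersion_term_ge0.
have lamfin : dispersion (@lambda R p) a \is a fin_num.
  by rewrite ge0_fin_numE// (le_lt_trans (dispersion_lambda_le a)).
have diff0 x : 0 <= vnorm R (x - a) ^+ 2 - lambda R (x - a) ^+ 2.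
  rewrite subr_ge0 lerXn2r ?nnegrE ?lambda_ge0 ?vnorm_ge0//.
  exact: lambda_le_vnorm.
have mdiff : measurable_fun [set: G]
    (fun x => vnorm R (x - a) ^+ 2 - lambda R (x - a) ^+ 2).
  apply: measurable_funB; apply: measurable_funX; apply: measurable_fun_subr.
    exact: measurable_vnorm.
  exact: measurable_lambda.
(* Adding the integral of the gap avoids subtracting extended reals; it is positive because the gap
   vanishes only on a null set. *)
have -> : dispersion (@vnorm R p) a = (dispersion (@lambda R p) a +
    \int[mu]_x ((vnorm R (x - a) ^+ 2 - lambda R (x - a) ^+ 2)%R * g x)%:E)%E.
  rewrite /dispersion -ge0_integralD//; last 3 first.
  - by apply: measurable_dispersion; exact: measurable_lambda.
  - by move=> x _; rewrite lee_fin mulr_ge0.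
  - by apply/measurable_EFinP; exact: measurable_funM.
  by apply: eq_integral => x _; rewrite -EFinD; congr EFin; ring.
rewrite lteDl//; apply: integral_weight_gt0 => //.
Qed.

Lemma dispersion_vnorm_gt0 a : (0 < dispersion (@vnorm R p) a)%E.
Proof.
apply: integral_weight_gt0 => [|x|]; last 2 first.
- exact: sqr_ge0.
- apply: (@negligibleS _ _ _ _ [set a]); last first.
    by exists [set a]; split=> //; [exact: measurable_vset1|exact: haar_set1].
  move=> x /= /eqP; rewrite sqrf_eq0 => /eqP xa.
  apply: contrapT => /eqP nxa; have := vnorm_gt0 R hp (x := x - a).
  by rewrite subr_eq0 nxa xa ltxx => /(_ isT).
apply: measurable_funX; apply: measurable_fun_subr; exact: measurable_vnorm.
Qed.

End Weight.
End Dispersion.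

(** * Characters *)

Section Phase.
Variables (R : realType) (p : nat).
Hypothesis hp : (1 < p)%N.
Local Notation G := (vilenkin p).

(** The exponent of the character restricted to positions from -k to k-1, kept a natural number so
    that additivity modulo [p] becomes an equation with an explicit multiple of [p]. *)
Definition pairing (k : nat) (x w : G) : nat :=
  (\sum_(i < k.*2) (x (i%:Z - k%:Z)%R : nat) * w (- 1 - (i%:Z - k%:Z))%R)%N.

(** The argument of [chi x w], whose real and imaginary parts are its cosine and sine. *)
Definition phase (x w : G) : R := 2 * pi / p%:R *
  \sum_(j \in [set: int]) (((x j : nat) * (w (- 1 - j)%R : nat))%:R : R).

(** [x] kills the positions below -k, and [w], read at -1-j, kills those from k on. *)
Lemma phaseE k x w : vball 0 (- k%:Z) x -> vball 0 (- k%:Z) w ->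
  phase x w = 2 * pi / p%:R * (pairing k x w)%:R.
Proof.
move=> x0 w0; rewrite /phase /pairing; congr (_ * _).
rewrite (fsbigE [seq i%:Z - k%:Z | i <- iota 0 k.*2]) => [||//|j _ jr].
- rewrite big_map natr_sum -(big_mkord xpredT
    (fun i => ((x (i%:Z - k%:Z) : nat) * w (- 1 - (i%:Z - k%:Z)))%:R)).
  rewrite /index_iota subn0.
  by apply: eq_bigl => i; rewrite in_setT.
- by rewrite map_inj_uniq ?iota_uniq// => i j /addIr[].
- have [jk|kj] := ltP j (- k%:Z); first by rewrite x0// mul0n.
  rewrite w0 ?muln0//; suff : k%:Z <= j by lia.
  rewrite leNgt; apply/negP => jk; move/negP: jr; apply.
  apply/mapP; exists (absz (j + k%:Z)); last lia.
  by rewrite mem_iota; lia.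
Qed.

Lemma digitD_nat (x y : G) j : ((x j : nat) + y j)%N =
  ((x + y)%R j + p * (((x j : nat) + y j) %/ p))%N.
Proof.
rewrite digitD [nat_of_ord (x j + y j)]/=.
move: (nat_of_ord (x j)) (nat_of_ord (y j)) => a b.
by rewrite (Zp_cast hp) [RHS]addnC [(p * _)%N]mulnC -divn_eq.
Qed.

(** [q] collects the carries lost when the digits of [x + y] are reduced modulo [p]. *)
Lemma pairingDl k x y w : exists q,
  (pairing k x w + pairing k y w = pairing k (x + y)%R w + p * q)%N.
Proof.
exists (\sum_(i < k.*2) (((x (i%:Z - k%:Z)%R : nat) + y (i%:Z - k%:Z)%R) %/ p) *
  w (- 1 - (i%:Z - k%:Z))%R)%N.
rewrite -big_split/= big_distrr/= -big_split/=; apply: eq_bigr => i _.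
by rewrite -mulnDl [in LHS]digitD_nat mulnDl mulnA.
Qed.

Lemma pairingDr k x w v : exists q,
  (pairing k x w + pairing k x v = pairing k x (w + v)%R + p * q)%N.
Proof.
pose j (i : nat) : int := - 1 - (i%:Z - k%:Z).
exists (\sum_(i < k.*2) x (i%:Z - k%:Z)%R *
  (((w (j i) : nat) + v (j i)) %/ p))%N.
rewrite -big_split/= big_distrr/= -big_split/=; apply: eq_bigr => i _.
by rewrite -mulnDr [in LHS]digitD_nat mulnDr mulnCA.
Qed.

(** The threshold form, valid for all larger [l], is what the eventual constancy in
    [measurable_phase] requires. *)
Lemma vball_common (x y z : G) : exists k : nat, forall l, (k <= l)%N ->
  [/\ vball 0 (- l%:Z) x, vball 0 (- l%:Z) y & vball 0 (- l%:Z) z].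
Proof.
have [k1 x0] := vball_exists x; have [k2 y0] := vball_exists y.
have [k3 z0] := vball_exists z; exists (maxn k1 (maxn k2 k3)) => l kl.
by split; [move: x0|move: y0|move: z0]; apply: vball_le; lia.
Qed.

Lemma vballD (x y : G) n : vball 0 n x -> vball 0 n y -> vball 0 n (x + y).
Proof. by move=> x0 y0 j jn; rewrite digitD x0// y0// addr0. Qed.

Lemma cos_sin_period (a b c : nat) : (exists q, a + b = c + p * q)%N ->
  let t (n : nat) : R := 2 * pi / p%:R * n%:R in
  cos (t a + t b) = cos (t c) /\ sin (t a + t b) = sin (t c).
Proof.
move=> [q abc] t.
have -> : t a + t b = t c + (pi *+ 2) *+ q.
  rewrite /t -mulrDr -natrD abc natrD natrM mulrDr; congr (_ + _).
  by field; exact: p_neq0.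
by split; [exact: (periodicn (@cosD2pi R))|exact: (periodicn (@sinD2pi R))].
Qed.

(** [phase] is additive only up to multiples of 2 pi, so additivity is stated after taking cosine
    and sine. *)
Lemma phaseDl x y w : cos (phase x w + phase y w) = cos (phase (x + y) w) /\
  sin (phase x w + phase y w) = sin (phase (x + y) w).
Proof.
have [k /(_ k (leqnn k))[x0 y0 w0]] := vball_common x y w.
rewrite !(phaseE (k := k))//; last exact: vballD.
by apply: cos_sin_period; exact: pairingDl.
Qed.

Lemma phaseDr x w v : cos (phase x w + phase x v) = cos (phase x (w + v)) /\
  sin (phase x w + phase x v) = sin (phase x (w + v)).
Proof.
have [k /(_ k (leqnn k))[x0 w0 v0]] := vball_common x w v.
rewrite !(phaseE (k := k))//; last exact: vballD.
by apply: cos_sin_period; exact: pairingDr.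
Qed.

Lemma cos_phaseB x a w : cos (phase (x - a) w) =
  cos (phase x w) * cos (phase a w) + sin (phase x w) * sin (phase a w).
Proof.
have [c s] := phaseDl (x - a) a w; rewrite subrK in c s.
rewrite -c -s cosD sinD; set t := phase (x - a) w; set u := phase a w.
rewrite -[LHS]mulr1 -(cos2Dsin2 u); ring.
Qed.

Lemma sin_phaseB x a w : sin (phase (x - a) w) =
  sin (phase x w) * cos (phase a w) - cos (phase x w) * sin (phase a w).
Proof.
have [c s] := phaseDl (x - a) a w; rewrite subrK in c s.
rewrite -c -s cosD sinD; set t := phase (x - a) w; set u := phase a w.
rewrite -[LHS]mulr1 -(cos2Dsin2 u); ring.
Qed.

Lemma measurable_digit j : measurable_fun [set: G]
  (fun x : G => (x j : nat)%:R : R).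
Proof.
apply: (@measurable_locally_constant _ _ _ _ (j + 1)) => x y xy.
by rewrite xy//; lia.
Qed.

(** Pointwise limit of the truncated exponents: each depends on finitely many digits, and at a given
    point they are eventually equal to the phase. *)
Lemma measurable_phase :
  measurable_fun [set: G * G] (fun z : G * G => phase z.1 z.2).
Proof.
pose S k (z : G * G) := 2 * pi / p%:R * (pairing k z.1 z.2)%:R : R.
apply: (measurable_fun_cvg (h := S)) => [k|z _].
  apply: measurable_funM => //.
  under eq_fun do rewrite natr_sum.
  apply: measurable_sum => i; under eq_fun do rewrite natrM.
  apply: measurable_funM.
    exact: (measurableT_comp (measurable_digit _) (@measurable_fst _ _ _ _)).
  exact: (measurableT_comp (measurable_digit _) (@measurable_snd _ _ _ _)).
apply: cvg_near_cst.
have [k hk] := vball_common z.1 z.2 0.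
exists k => // l /= kl; have [z1 z2 _] := hk l kl.
by rewrite /S -phaseE.
Qed.

Lemma phase_eq0 m x w : vball 0 (- m) x -> vball 0 m w -> phase x w = 0.
Proof.
move=> x0 w0; rewrite /phase fsbig1 ?mulr0// => j _.
have [jm|mj] := ltP j (- m); first by rewrite x0// mul0n.
by rewrite w0 ?muln0//; lia.
Qed.

(* A digit of [x] dual to the ball [vball 0 m] gives a translation of that
   ball which multiplies the character by a nontrivial root of unity. *)
Lemma phase_nontrivial m x : ~ vball 0 (- m) x ->
  exists2 v, vball 0 m v & cos (phase x v) != 1.
Proof.
move=> /existsNP[j /not_implyP[jm /eqP xj]].
pose v : G := vseq (- 1 - j) (fun i => if i == - 1 - j then 1 else 0).
have v1 : v (- 1 - j) = 1 by rewrite vseqE ltxx eqxx.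
have v0 i : i != - 1 - j -> v i = 0.
  by move=> ij; rewrite vseqE (negbTE ij); case: ifP.
exists v; first by move=> i im; rewrite v0//; lia.
have -> : phase x v = (2 * pi / p%:R * (x j : nat)%:R).
  rewrite /phase (fsbigE [:: j])// => [|i _]; last first.
    rewrite inE => ij; rewrite v0 ?muln0//.
    by apply: contra ij => /eqP ?; apply/eqP; lia.
  rewrite big_cons big_nil in_setT [X in _ * X]addr0 v1.
  suff -> : nat_of_ord (1 : 'Z_p) = 1%N by rewrite muln1.
  by rewrite /= modn_small.
set k : R := (x j : nat)%:R.
have k0 : 0 < k.
  by rewrite ltr0n lt0n; apply: contra xj => /eqP xj; apply/eqP/val_inj.
have kp : k < p%:R by rewrite ltr_nat digit_lt.
have p0 := p_gt0 R hp.
(* The phase is 2t with 0 < t < pi, so its cosine 1 - 2 (sin t)^2 is less than 1. *)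
pose t : R := pi * (k / p%:R).
have -> : 2 * pi / p%:R * k = t + t by rewrite /t; field; exact: p_neq0.
have st : 0 < sin t.
  apply: sin_gt0_pi; rewrite mulr_gt0 ?divr_gt0 ?pi_gt0//=.
  by rewrite gtr_pMr ?pi_gt0// ltr_pdivrMr// mul1r.
rewrite cosD; apply/negP => /eqP h.
have := cos2Dsin2 t; have := mulr_gt0 st st; rewrite !expr2; lra.
Qed.

End Phase.

(** * Fourier inversion on balls *)

Section BoundedKernel.
Context d (T : measurableType d) (R : realType).
Variable mu : {measure set T -> \bar R}.

Lemma integrable_bounded_mul (D : set T) (v k : T -> R) :
  measurable D -> mu.-integrable D (EFin \o v) -> measurable_fun D k ->
  (forall x, `|k x| <= 1) -> mu.-integrable D (EFin \o (fun x => v x * k x)).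
Proof.
move=> mD iv mk k1; apply: (le_integrable mD _ _ iv).
  apply/measurable_EFinP/measurable_funM => //.
  exact/measurable_EFinP/(measurable_int _ iv).
by move=> x _; rewrite lee_fin normrM ler_piMr.
Qed.

Lemma integrable_bounded (D : set T) (k : T -> R) (M : R) :
  measurable D -> (mu D < +oo)%E -> measurable_fun D k ->
  (forall x, `|k x| <= M) -> mu.-integrable D (EFin \o k).
Proof.
move=> mD muD mk kM.
have iM : mu.-integrable D (EFin \o cst M).
  apply/integrableP; split; first exact/measurable_EFinP/measurable_cst.
  rewrite (eq_integral (cst `|M|%:E))//.
  by rewrite integral_cst// lte_mul_pinfty.
apply: (le_integrable mD _ _ iM); first exact/measurable_EFinP.
by move=> x _; rewrite lee_fin (le_trans (kM x))// ler_norm.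
Qed.

End BoundedKernel.

Section FubiniKernel.
Context d1 d2 (T1 : measurableType d1) (T2 : measurableType d2) (R : realType).
Variable mu : {sigma_finite_measure set T1 -> \bar R}.
Variable nu : {sigma_finite_measure set T2 -> \bar R}.

Lemma Fubini_kernel (v : T1 -> R) (k : T1 * T2 -> R) (B : set T2) :
  mu.-integrable setT (EFin \o v) -> measurable_fun setT k ->
  (forall z, `|k z| <= 1) -> measurable B -> (nu B < +oo)%E ->
  \int[nu]_(w in B) (\int[mu]_x (v x * k (x, w))) =
  \int[mu]_x (v x * \int[nu]_(w in B) k (x, w)).
Proof.
move=> iv mk k1 mB nuB.
(* The indicator of [B] moves the problem to the whole product space, where [F] is integrable
   because |k| <= 1 and [B] has finite measure. *)
pose F (z : T1 * T2) : \bar R := (v z.1 * k z * \1_B z.2)%:E.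
have mv : measurable_fun setT v by exact/measurable_EFinP/(measurable_int _ iv).
have mF : measurable_fun setT F.
  apply/measurable_EFinP; apply: measurable_funM.
    apply: measurable_funM => //.
    exact: (measurableT_comp mv (@measurable_fst _ _ _ _)).
  exact: (measurableT_comp (measurable_indic mB) (@measurable_snd _ _ _ _)).
have mk1 x : measurable_fun setT (fun w => k (x, w)).
  exact: (measurableT_comp mk (measurable_pair1 x)).
have mk2 w : measurable_fun setT (fun x => k (x, w)).
  exact: (measurableT_comp mk (measurable_pair2 w)).
have iF : (mu \x nu)%E.-integrable setT F.
  apply/integrable12ltyP => //.
  apply: (@le_lt_trans _ _ (\int[mu]_x (`|(v x)%:E| * nu B))%E).
    apply: ge0_le_integral => //.
    - by move=> x _; exact: integral_ge0.
    - apply: (measurable_fun_fubini_tonelli_F (fun z => `|F z|%E)) => //.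
      exact: measurableT_comp.
    - apply: emeasurable_funM => //; apply: measurableT_comp => //.
      exact/measurable_EFinP.
    - move=> x _; rewrite -[X in (_ * nu X)%E]setIT -integral_indic//.
      rewrite -ge0_integralZl//; last first.
        exact/measurable_EFinP/measurable_indic.
      apply: ge0_le_integral => //.
      + apply: measurableT_comp => //.
        exact: (measurableT_comp mF (measurable_pair1 x)).
      + apply: emeasurable_funM => //; exact/measurable_EFinP/measurable_indic.
      + move=> w _; rewrite /F/= -EFinM lee_fin !normrM.
        rewrite [`|\1_B w|]ger0_norm ?indicE ?ler0n// ler_wpM2r ?ler0n//.
        by rewrite ler_piMr.
  rewrite ge0_integralZr//; last first.
    by apply: measurableT_comp => //; exact/measurable_EFinP.
  have /integrableP[_ vlt] := iv.
  by rewrite lte_mul_pinfty ?integral_ge0// ge0_fin_numE// integral_ge0.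
have ik x : nu.-integrable B (EFin \o (fun w => k (x, w))).
  apply: (@integrable_bounded _ _ _ _ _ _ 1) => //.
  exact: measurable_funTS.
have ivk w : mu.-integrable setT (EFin \o (fun x => v x * k (x, w))).
  exact: integrable_bounded_mul.
have Fw w : (\int[mu]_x F (x, w) =
    (((fun w => \int[mu]_x (v x * k (x, w))) \_ B) w)%:E)%E.
  rewrite /F /patch/= indicE; case: ifPn => wB.
    under eq_integral do rewrite mulr1.
    by rewrite /Rintegral fineK//; apply: integrable_fin_num => //; exact: ivk.
  by under eq_integral do rewrite mulr0; rewrite integral0.
have Fx x : (\int[nu]_w F (x, w) = (v x * \int[nu]_(w in B) k (x, w))%:E)%E.
  rewrite -RintegralZl// /Rintegral fineK; last first.
    apply: integrable_fin_num => //.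
    apply: (@integrable_bounded _ _ _ _ _ (fun w => v x * k (x, w)) `|v x|)
      => //.
      by apply: measurable_funM => //; exact: measurable_funTS.
    by move=> w; rewrite normrM ler_piMr.
  rewrite [RHS]integral_mkcond; apply: eq_integral => w _.
  by rewrite /F /patch/= indicE; case: ifPn => _; rewrite ?mulr1 ?mulr0.
have := Fubini iF.
under eq_integral do rewrite Fx.
under [RHS]eq_integral do rewrite Fw.
by rewrite Rintegral_mkcond /Rintegral => <-.
Qed.

(** Tonelli treats the positive and negative parts separately, and [fine] is measurable, so its
    default value at infinite integrals does no harm. *)
Lemma measurable_Rintegral1 (F : T1 * T2 -> R) : measurable_fun setT F ->
  measurable_fun [set: T2] (fun w => \int[mu]_x F (x, w)).
Proof.
move=> mF; have mEF : measurable_fun setT (EFin \o F) by exact/measurable_EFinP.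
apply: (measurableT_comp (@fine_measurable R setT measurableT) _) => //.
under eq_fun do rewrite integralE.
apply: emeasurable_funB.
  have -> : (fun w => \int[mu]_x ((fun x => (F (x, w))%:E)^\+ x))%E =
      (fun w => \int[mu]_x ((EFin \o F)^\+ (x, w)))%E.
    by apply/funext => w; apply: eq_integral => x _; rewrite !funeposE.
  apply: (measurable_fun_fubini_tonelli_G (EFin \o F)^\+%E) => //.
  exact: measurable_funepos.
have -> : (fun w => \int[mu]_x ((fun x => (F (x, w))%:E)^\- x))%E =
    (fun w => \int[mu]_x ((EFin \o F)^\- (x, w)))%E.
  by apply/funext => w; apply: eq_integral => x _; rewrite !funenegE.
apply: (measurable_fun_fubini_tonelli_G (EFin \o F)^\-%E) => //.
exact: measurable_funeneg.
Qed.

End FubiniKernel.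

Section AmGm.
Context d (T : measurableType d) (R : realType).
Variable mu : {measure set T -> \bar R}.

(* AM-GM: [|X| <= e + X^2 / e], integrated over a set of finite measure. *)
Lemma normr_Rintegral_le_sq (D : set T) (X Q : T -> R) (e delta : R) :
  measurable D -> (mu D < +oo)%E -> measurable_fun D X ->
  measurable_fun setT Q -> (forall x, X x ^+ 2 <= Q x) ->
  (\int[mu]_x (Q x)%:E <= delta%:E)%E -> 0 < e ->
  mu.-integrable D (EFin \o X) /\
  `|\int[mu]_(x in D) X x| <= e * fine (mu D) + delta / e.
Proof.
move=> mD muD mX mQ XQ Qdelta e0.
have Q0 x : 0 <= Q x by rewrite (le_trans _ (XQ x))// sqr_ge0.
have iQT : mu.-integrable setT (EFin \o Q).
  apply/integrableP; split; first exact/measurable_EFinP.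
  under eq_integral do rewrite gee0_abs ?lee_fin//.
  exact: le_lt_trans Qdelta (ltry _).
have iQ : mu.-integrable D (EFin \o Q) by exact: integrableS iQT.
have iQe : mu.-integrable D (EFin \o (fun x => e^-1 * Q x)).
  rewrite (_ : _ \o _ = fun x => (e^-1%:E * (Q x)%:E)%E)//.
  exact: integrableZl.
have ie : mu.-integrable D (EFin \o (fun=> e)).
  by apply: (@integrable_bounded _ _ _ _ _ _ `|e|).
have ieQ : mu.-integrable D (EFin \o (fun x => e + e^-1 * Q x)).
  rewrite (_ : _ \o _ = fun x => (e%:E + (e^-1 * Q x)%R%:E)%E)//.
  exact: integrableD.
have XeQ x : `|X x| <= e + e^-1 * Q x.
  rewrite -(ler_pM2l e0) mulrDr mulrA divff ?gt_eqF// mul1r.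
  have := XQ x; rewrite -(real_normK (num_real (X x))).
  have : 0 <= (`|X x| - e) ^+ 2 by exact: sqr_ge0.
  have := normr_ge0 (X x); move: `|X x| (Q x) => a q; rewrite !expr2 => *; nra.
have iX : mu.-integrable D (EFin \o X).
  apply: le_integrable ieQ => //; first exact/measurable_EFinP.
  by move=> x _; rewrite lee_fin (le_trans (XeQ x))// ler_norm.
split=> //; apply: (le_trans (le_normr_Rintegral mD iX)).
apply: (@le_trans _ _ (\int[mu]_(x in D) (e + e^-1 * Q x))).
  apply: le_Rintegral => //.
  by have := integrable_norm iX.
rewrite RintegralD// Rintegral_cst// RintegralZl// lerD2l mulrC ler_wpM2r//.
  by rewrite invr_ge0 ltW.
rewrite -lee_fin /Rintegral fineK; last exact: integrable_fin_num.
apply: le_trans Qdelta; apply: ge0_subset_integral => //.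
- exact/measurable_EFinP.
- by move=> x _; rewrite lee_fin.
Qed.

End AmGm.

(** * Orthogonality of characters and the inversion formula *)

Section Inversion.
Variables (R : realType) (p : nat).
Hypothesis hp : (1 < p)%N.
Local Notation G := (vilenkin p).
Local Notation w n := ((p%:R : R) ^ (- n)).
Variable mu : {sigma_finite_measure set G -> \bar R}.
Hypothesis hmu : haar_measure mu.

Local Notation cosp x w := (cos (@phase R p x w)).
Local Notation sinp x w := (sin (@phase R p x w)).

Lemma measurable_cos_phase :
  measurable_fun [set: G * G] (fun z => cosp z.1 z.2).
Proof.
exact: (measurableT_comp (continuous_measurable_fun (@continuous_cos R))
  (@measurable_phase R p hp)).
Qed.

Lemma measurable_sin_phase :
  measurable_fun [set: G * G] (fun z => sinp z.1 z.2).
Proof.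
exact: (measurableT_comp (continuous_measurable_fun (@continuous_sin R))
  (@measurable_phase R p hp)).
Qed.

Lemma norm_cos_le1 (t : R) : `|cos t| <= 1.
Proof. by rewrite ler_norml cos_geN1 cos_le1. Qed.

Lemma norm_sin_le1 (t : R) : `|sin t| <= 1.
Proof. by rewrite ler_norml sin_geN1 sin_le1. Qed.

Lemma measurable_section (k : G * G -> R) x :
  measurable_fun setT k -> measurable_fun [set: G] (fun w => k (x, w)).
Proof. by move=> mk; exact: (measurableT_comp mk (measurable_pair1 x)). Qed.

Lemma measurable_cos_phase1 x : measurable_fun [set: G] (fun w => cosp x w).
Proof. exact: (measurable_section x measurable_cos_phase). Qed.

Lemma measurable_sin_phase1 x : measurable_fun [set: G] (fun w => sinp x w).
Proof. exact: (measurable_section x measurable_sin_phase). Qed.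

Lemma integrable_ball (k : G -> R) m : measurable_fun [set: G] k ->
  (forall x, `|k x| <= 1) -> mu.-integrable (vball 0 m) (EFin \o k).
Proof.
move=> mk k1; apply: (@integrable_bounded _ _ _ _ _ _ 1) => //.
- exact: vball_measurable.
- exact: haar_vball_lty.
- exact: measurable_funTS.
Qed.

Lemma Rintegral_ball_translation (f : G -> R) m v : vball 0 m v ->
  mu.-integrable (vball 0 m) (EFin \o f) ->
  \int[mu]_(x in vball 0 m) f (v + x) = \int[mu]_(x in vball 0 m) f x.
Proof.
move=> v0 /(integrable_mkcond _ (vball_measurable 0 m)).
rewrite restrict_EFin => fi.
rewrite Rintegral_mkcond [RHS]Rintegral_mkcond /Rintegral; congr fine.
rewrite -[RHS](integral_translation hmu v fi); apply: eq_integral => x _ /=.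
rewrite /patch; congr (if _ then _ else _)%:E.
apply/idP/idP; rewrite !inE => x0; first exact: vballD.
by rewrite -[x](addKr v); apply: vballD => // j jm; rewrite digitN v0// oppr0.
Qed.

Lemma character_orthogonality m y : ~ vball 0 (- m) y ->
  \int[mu]_(x in vball 0 m) cosp y x = 0 /\
  \int[mu]_(x in vball 0 m) sinp y x = 0.
Proof.
move=> /(phase_nontrivial R hp)[v v0 cv].
have ic := integrable_ball m (measurable_cos_phase1 y) (fun=> norm_cos_le1 _).
have is_ := integrable_ball m (measurable_sin_phase1 y) (fun=> norm_sin_le1 _).
have mB := vball_measurable (0 : G) m.
have iZ r (f : G -> R) : mu.-integrable (vball 0 m) (EFin \o f) ->
    mu.-integrable (vball 0 m) (EFin \o (fun x => r * f x)).
  move=> fi; rewrite (_ : _ \o _ = fun x => (r%:E * (f x)%:E)%E)//.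
  exact: integrableZl.
have := Rintegral_ball_translation v0 ic.
under eq_Rintegral do rewrite -(phaseDr R hp y v _).1 cosD.
rewrite RintegralB ?RintegralZl//; [|exact: iZ|exact: iZ].
have := Rintegral_ball_translation v0 is_.
under eq_Rintegral do rewrite -(phaseDr R hp y v _).2 sinD.
rewrite RintegralD ?RintegralZl//; [|exact: iZ|exact: iZ].
set C := Rintegral _ _ _; set S := Rintegral _ _ _.
have := cos2Dsin2 (@phase R p y v); set c := cos _; set s := sin _ => cs hS hC.
(* Translating the ball by [v] rotates the vector (C, S) by an angle with cosine [c], yet leaves it
   fixed. The linear system so obtained has determinant (1 - c)^2 + s^2 = 2 (1 - c), which is
   nonzero. *)
have c1 : 1 - c != 0 by rewrite subr_eq0 eq_sym.
have e1 : (1 - c) * C = - (s * S) by lra.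
have e2 : (1 - c) * S = s * C by lra.
have c2 : 2 * (1 - c) = (1 - c) ^+ 2 + s ^+ 2.
  by move: cs; rewrite !expr2; lra.
have nz : 2 * (1 - c) != 0 by rewrite mulf_neq0.
split; apply: (mulfI nz); rewrite mulr0 c2 mulrDl.
  by rewrite expr2 -mulrA e1 mulrN mulrCA e2 expr2 mulrA addNr.
by rewrite expr2 -mulrA e2 mulrCA e1 mulrN expr2 mulrA addNr.
Qed.

Lemma character_integral m y : vball 0 (- m) y ->
  \int[mu]_(x in vball 0 m) cosp y x = w m /\
  \int[mu]_(x in vball 0 m) sinp y x = 0.
Proof.
move=> y0; have mB := vball_measurable (0 : G) m.
have E x : x \in vball 0 m -> @phase R p y x = 0.
  by rewrite inE; exact: phase_eq0.
split.
  rewrite (@eq_Rintegral _ _ _ mu _ (fun=> 1)) => [|x xm]; last first.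
    by rewrite E// cos0.
  by rewrite Rintegral_cst// mul1r (haar_vballE hp hmu).
rewrite (@eq_Rintegral _ _ _ mu _ (fun=> 0)) => [|x xm]; last first.
  by rewrite E// sin0.
by rewrite Rintegral_cst// mul0r.
Qed.

Section Pair.
Variables v1 v2 : G -> R.
Hypothesis iv1 : mu.-integrable setT (EFin \o v1).
Hypothesis iv2 : mu.-integrable setT (EFin \o v2).

(* Real and imaginary parts of the Fourier transform of [v1 + i v2]. *)
Definition fourier_re xi := \int[mu]_x (v1 x * cosp x xi + v2 x * sinp x xi).
Definition fourier_im xi := \int[mu]_x (v2 x * cosp x xi - v1 x * sinp x xi).

Lemma phase_swap (k : G * G -> R) xi : measurable_fun setT k ->
  measurable_fun [set: G] (fun x => k (x, xi)).
Proof. by move=> mk; exact: (measurableT_comp mk (measurable_pair2 xi)). Qed.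

Let icos v xi : mu.-integrable setT (EFin \o v) ->
  mu.-integrable setT (EFin \o (fun x => v x * cosp x xi)).
Proof.
move=> iv; apply: integrable_bounded_mul => //.
  exact: (phase_swap xi measurable_cos_phase).
by move=> x; exact: norm_cos_le1.
Qed.

Let isin v xi : mu.-integrable setT (EFin \o v) ->
  mu.-integrable setT (EFin \o (fun x => v x * sinp x xi)).
Proof.
move=> iv; apply: integrable_bounded_mul => //.
  exact: (phase_swap xi measurable_sin_phase).
by move=> x; exact: norm_sin_le1.
Qed.

Let mcos v : mu.-integrable setT (EFin \o v) ->
  measurable_fun setT (fun z : G * G => v z.1 * cosp z.1 z.2).
Proof.
move=> /measurable_int/measurable_EFinP mv; apply: measurable_funM.
  exact: (measurableT_comp mv (@measurable_fst _ _ _ _)).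
exact: measurable_cos_phase.
Qed.

Let msin v : mu.-integrable setT (EFin \o v) ->
  measurable_fun setT (fun z : G * G => v z.1 * sinp z.1 z.2).
Proof.
move=> /measurable_int/measurable_EFinP mv; apply: measurable_funM.
  exact: (measurableT_comp mv (@measurable_fst _ _ _ _)).
exact: measurable_sin_phase.
Qed.

Lemma measurable_fourier_re : measurable_fun [set: G] fourier_re.
Proof.
apply: (@measurable_Rintegral1 _ _ _ _ _ mu
  (fun z => v1 z.1 * cosp z.1 z.2 + v2 z.1 * sinp z.1 z.2)).
by apply: measurable_funD; [exact: mcos|exact: msin].
Qed.

Lemma measurable_fourier_im : measurable_fun [set: G] fourier_im.
Proof.
apply: (@measurable_Rintegral1 _ _ _ _ _ mu
  (fun z => v2 z.1 * cosp z.1 z.2 - v1 z.1 * sinp z.1 z.2)).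
by apply: measurable_funB; [exact: mcos|exact: msin].
Qed.

(** The left side is the imaginary part of the transform of v2 - i v1 = -i (v1 + i v2). It lets the
    imaginary part of a function be handled as a real part. *)
Lemma fourier_im_swap xi :
  \int[mu]_x (- v1 x * cosp x xi - v2 x * sinp x xi) = - fourier_re xi.
Proof.
rewrite -mulN1r /fourier_re -RintegralZl//.
  by apply: eq_Rintegral => x _; rewrite mulN1r opprD mulNr.
rewrite (_ : _ \o _ =
  fun x => ((v1 x * cosp x xi)%:E + (v2 x * sinp x xi)%:E)%E)//.
by have := integrableD measurableT (icos xi iv1) (isin xi iv2); exact.
Qed.

(** The real part of [chi a xi] times the transform: the modulation turns the kernel in [x] into the
    one in [x - a]. *)
Lemma fourier_modulate a xi :
  cosp a xi * fourier_re xi - sinp a xi * fourier_im xi =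
  \int[mu]_x (v1 x * cosp (x - a) xi) + \int[mu]_x (v2 x * sinp (x - a) xi).
Proof.
rewrite /fourier_re /fourier_im.
rewrite RintegralD ?RintegralB//;
  [|exact: icos|exact: isin|exact: icos|exact: isin].
under [X in _ = X + _]eq_Rintegral do rewrite (cos_phaseB R hp) mulrDr !mulrA.
under [X in _ = _ + X]eq_Rintegral do rewrite (sin_phaseB R hp) mulrBr !mulrA.
have ir (f : G -> R) r : mu.-integrable setT (EFin \o f) ->
    mu.-integrable setT (EFin \o (fun x => f x * r)).
  move=> fi; rewrite (_ : _ \o _ = fun x => ((f x)%:E * r%:E)%E)//.
  exact: integrableZr.
rewrite RintegralD//; [|by apply: ir; exact: icos|by apply: ir; exact: isin].
rewrite RintegralB//; [|by apply: ir; exact: isin|by apply: ir; exact: icos].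
rewrite !RintegralZr//; [|exact: icos|exact: isin|exact: isin|exact: icos].
lra.
Qed.

Lemma fourier_inversion_ball a m :
  \int[mu]_(xi in vball 0 m)
    (cosp a xi * fourier_re xi - sinp a xi * fourier_im xi) =
  w m * \int[mu]_(x in vball a (- m)) v1 x.
Proof.
have mB := vball_measurable (0 : G) m.
have muB := haar_vball_lty hp hmu (0 : G) m.
have mBa := vball_measurable a (- m).
under eq_Rintegral do rewrite fourier_modulate.
pose shift (z : G * G) : G * G := (z.1 - a, z.2).
have mshift : measurable_fun setT shift.
  apply: measurable_fun_pair; last exact: measurable_snd.
  under eq_fun do rewrite addrC.
  exact: (measurableT_comp (measurable_translation (- a))
    (@measurable_fst _ _ _ _)).
have mc : measurable_fun setT (fun z : G * G => cosp (z.1 - a) z.2).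
  exact: (measurableT_comp measurable_cos_phase mshift).
have ms : measurable_fun setT (fun z : G * G => sinp (z.1 - a) z.2).
  exact: (measurableT_comp measurable_sin_phase mshift).
(* Splitting the outer integral needs each inner integral to be integrable over the ball; it is
   bounded by the integral of |v|. *)
have iJ (v : G -> R) (k : G * G -> R) : mu.-integrable setT (EFin \o v) ->
    measurable_fun setT k -> (forall z, `|k z| <= 1) ->
    mu.-integrable (vball 0 m)
      (EFin \o (fun xi => \int[mu]_x (v x * k (x, xi)))).
  move=> iv mk k1.
  have /measurable_int/measurable_EFinP mv := iv.
  have mk2 xi : measurable_fun [set: G] (fun x => k (x, xi)).
    exact: phase_swap.
  apply: (@integrable_bounded _ _ _ _ _ _ (\int[mu]_x `|v x|)) => //.
    apply: measurable_funTS.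
    apply: (@measurable_Rintegral1 _ _ _ _ _ mu (fun z => v z.1 * k z)).
    apply: measurable_funM => //.
    exact: (measurableT_comp mv (@measurable_fst _ _ _ _)).
  move=> xi.
  have ivk : mu.-integrable setT (EFin \o (fun x => v x * k (x, xi))).
    exact: integrable_bounded_mul.
  apply: le_trans (le_normr_Rintegral _ ivk) _ => //.
  apply: le_Rintegral => //.
  - by have := integrable_norm ivk.
  - by have := integrable_norm iv.
  - by move=> x _; rewrite normrM ler_piMr.
rewrite RintegralD//; [|exact: (iJ _ _ iv1 mc (fun z => norm_cos_le1 _))
                       |exact: (iJ _ _ iv2 ms (fun z => norm_sin_le1 _))].
rewrite (Fubini_kernel (k := fun z : G * G => cosp (z.1 - a) z.2))//;
  last by move=> z; exact: norm_cos_le1.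
rewrite (Fubini_kernel (k := fun z : G * G => sinp (z.1 - a) z.2))//;
  last by move=> z; exact: norm_sin_le1.
(* The sine integrates to 0 over the ball both on and off the dual ball, so [v2] drops out. *)
rewrite (@eq_Rintegral _ _ _ mu _ (fun=> 0) (fun x => v2 x * _))
  => [|x _]; last first.
  have [xa|xa] := pselect (vball 0 (- m) (x - a)).
    by rewrite (character_integral xa).2 mulr0.
  by rewrite (character_orthogonality xa).2 mulr0.
rewrite Rintegral_cst// mul0r addr0 -RintegralZl//; last exact: integrableS iv1.
rewrite [RHS]Rintegral_mkcond.
apply: eq_Rintegral => x _; rewrite /patch; case: ifPn => xa /=.
  by rewrite (character_integral ((vballB a (- m) x).1 (set_mem xa))).1 mulrC.
rewrite (character_orthogonality _).1 ?mulr0// => /(vballB a (- m) x).2 xa'.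
by move: xa; rewrite mem_set.
Qed.

Lemma Rintegral_ball_le_fourier a m e delta : 0 < e ->
  (\int[mu]_xi (fourier_re xi ^+ 2 + fourier_im xi ^+ 2)%:E <= delta%:E)%E ->
  `|w m * \int[mu]_(x in vball a (- m)) v1 x| <= e * w m + delta / e.
Proof.
move=> e0 hdelta; rewrite -fourier_inversion_ball.
have muB : fine (mu (vball 0 m)) = w m by rewrite (haar_vballE hp hmu).
rewrite -[in leRHS]muB; apply: (normr_Rintegral_le_sq _ _ _ _ _ hdelta e0).2.
- exact: vball_measurable.
- exact: haar_vball_lty.
- apply: measurable_funTS; apply: measurable_funB; apply: measurable_funM.
  + exact: measurable_cos_phase1.
  + exact: measurable_fourier_re.
  + exact: measurable_sin_phase1.
  + exact: measurable_fourier_im.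
- apply: measurable_funD; apply: measurable_funX.
    exact: measurable_fourier_re.
  exact: measurable_fourier_im.
- move=> xi; have := cos2Dsin2 (@phase R p a xi).
  move: (cosp a xi) (sinp a xi) (fourier_re xi) (fourier_im xi) => c s A B cs.
  (* The imaginary part of the modulated transform: its square is the slack, since modulation
     preserves the modulus. *)
  have : 0 <= (s * A + c * B) ^+ 2 by exact: sqr_ge0.
  have -> : A ^+ 2 + B ^+ 2 = (c ^+ 2 + s ^+ 2) * (A ^+ 2 + B ^+ 2).
    by rewrite cs mul1r.
  rewrite !expr2; lra.
Qed.

End Pair.

End Inversion.

(** * Injectivity of the Fourier transform *)

Section Generation.
Variable p : nat.
Local Notation G := (vilenkin p).

(** The empty set is included so that the family is a pi-system: two balls are nested or
    disjoint. *)
Definition vballs : set (set G) :=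
  [set A | A = set0 \/ exists a n, A = vball a n].

Lemma vballI (a b : G) m n : m <= n ->
  vball a m `&` vball b n = set0 \/ vball a m `&` vball b n = vball b n.
Proof.
move=> mn; have [ab|ab] := pselect (vball a m b); [right|left].
  by apply: setIidr => x /(vball_le mn); exact: vball_trans.
apply/seteqP; split=> // x [xa /(vball_le mn) xb]; apply: ab.
exact: (vball_trans xa (vball_sym xb)).
Qed.

Lemma vballs_setI : setI_closed vballs.
Proof.
move=> A B [->|[a [m ->]]]; first by rewrite set0I; left.
move=> [->|[b [n ->]]]; first by rewrite setI0; left.
have [mn|/ltW nm] := leP m n.
  by have [->|->] := vballI a b mn; [left|right; exists b, n].
rewrite setIC.
by have [->|->] := vballI b a nm; [left|right; exists a, m].
Qed.

(* The points with finitely many nonzero digits form a countable dense set. *)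
Lemma open_bigcup_vballs (A : set G) : open A -> <<s vballs >> A.
Proof.
move=> oA.
(* [c (k, s)] is the cylinder of the sequences that vanish below -k and continue with the word [s].
   There are countably many words. *)
pose c (u : nat * seq 'Z_p) : set G := vball
  (vseq (- u.1%:Z) (fun j => nth 0 u.2 (absz (j + u.1%:Z))))
  ((size u.2)%:Z - u.1%:Z).
pose F u := if pselect (c u `<=` A) then c u else set0.
have -> : A = \bigcup_u F u.
  apply/seteqP; split=> [x Ax|x [u _]]; last first.
    by rewrite /F; case: pselect => // cA; exact: cA.
  have [n xn] := oA x Ax; have [k xk] := vball_exists x.
  pose s := [seq x (i%:Z - k%:Z) | i <- iota 0 (`|n|%N + k)].
  have cE : c (k, s) = vball x `|n|%N%:Z.
    rewrite /c/= size_map size_iota; rewrite (_ : _ - _ = `|n|%N%:Z); last lia.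
    apply: vball_eq => j jn; rewrite vseqE; case: ifPn => [jk|jk].
      by rewrite xk.
    rewrite (nth_map 0%N) ?size_iota ?nth_iota; [|lia|lia].
    by congr (digit x _); lia.
  exists (k, s) => //; rewrite /F.
  case: (pselect (c (k, s) `<=` A)) => /= [_|nA].
    by rewrite cE; exact: vball_refl.
  exfalso; apply: nA; rewrite cE => y xy.
  by apply: xn => j jn; apply: xy; lia.
apply: (@countable_bigcupT_measurable _ (g_sigma_algebraType vballs)).
  exact: countableP.
move=> u; rewrite /F; case: (pselect (c u `<=` A)) => /= _;
  last exact: measurable0.
by apply: sub_sigma_algebra; right; do 2 eexists.
Qed.

Lemma measurable_vballsE : @measurable _ G = <<s vballs >>.
Proof.
apply/seteqP; split; apply: smallest_sub; try exact: smallest_sigma_algebra.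
  exact: open_bigcup_vballs.
move=> _ [->|[a [n ->]]]; apply: open_measurable_vilenkin.
  by move=> x.
exact: vball_open.
Qed.

End Generation.

(** * Functions whose integrals over all balls vanish *)

Section Vanishing.
Variables (R : realType) (p : nat).
Local Notation G := (vilenkin p).
Variable mu : {measure set G -> \bar R}.

Lemma ae_eq0_of_vball_integrals (h : G -> R) :
  (forall a n, mu.-integrable (vball a n) (EFin \o h)) ->
  (forall a n, \int[mu]_(x in vball a n) h x = 0) ->
  {ae mu, forall x, h x = 0}.
Proof.
move=> ih h0.
have mh : measurable_fun [set: G] h.
  move=> _ B mB; rewrite setTI.
  rewrite (_ : h @^-1` B = \bigcup_(k : nat) (vball 0 (- k%:Z) `&` h @^-1` B)).
    apply: bigcupT_measurable => k.
    have /measurable_int/measurable_EFinP := ih 0 (- k%:Z).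
    by apply => //; exact: vball_measurable.
  by rewrite -setI_bigcupl vball_bigcupT setTI.
have intE a n : (\int[mu]_(x in vball a n) (h x)%:E = 0)%E.
  have /fineK <- : (\int[mu]_(x in vball a n) (h x)%:E)%E \is a fin_num.
    exact: (integrable_fin_num (vball_measurable a n) (ih a n)).
  by congr EFin; exact: h0.
have ball_ae k : mu.-negligible (vball 0 (- k%:Z) `&` [set x | h x != 0]).
  set D := vball 0 (- k%:Z); have mD : measurable D by exact: vball_measurable.
  have iD : mu.-integrable D (EFin \o h) by exact: ih.
  (* Induction from balls to measurable sets. Cutting by [D] keeps [h] integrable, as complements
     and countable unions require. *)
  have int0 S : measurable S -> (\int[mu]_(x in S `&` D) (h x)%:E = 0)%E.
    rewrite measurable_vballsE.
    apply: (dynkin_induction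
      (P := fun S => \int[mu]_(x in S `&` D) (h x)%:E = 0)%E
      (@measurable_vballsE p) (@vballs_setI p)).
    - by rewrite setTI; exact: intE.
    - move=> _ [->|[a [n ->]]]; first by rewrite set0I integral_set0.
      have [nk|/ltW kn] := leP n (- k%:Z).
        by have [->|->] := vballI a 0 nk; rewrite ?integral_set0// intE.
      rewrite setIC.
      by have [->|->] := vballI 0 a kn; rewrite ?integral_set0// intE.
    - move=> {}S mS S0.
      have DE : D = (S `&` D) `|` (~` S `&` D) by rewrite -setIUl setUv setTI.
      have := intE 0 (- k%:Z); rewrite -/D {1}DE integral_setU//.
      + by rewrite S0 add0e.
      + exact: measurableI.
      + by apply: measurableI => //; exact: measurableC.
      + by rewrite -DE; exact: measurable_int iD.
      + by apply/disj_setPS => x [[Sx _] [nSx _]].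
    - move=> F mF tF F0; rewrite setI_bigcupl integral_bigcup.
      + by apply: eseries0 => i _ _; exact: F0.
      + exact: trivIset_setIr.
      + by move=> i; exact: measurableI.
      + apply: integrableS iD => //.
          by apply: bigcupT_measurable => i; exact: measurableI.
        by move=> x [i _ []].
  have : ae_eq mu D (EFin \o h) (cst 0%E).
    apply: integral_ae_eq => // E ED mE.
    by rewrite integral_cst// mul0e -(setIidl ED) int0.
  by apply: negligibleS => x [Dx /eqP hx] /(_ Dx) [].
apply: negligibleS (negligible_bigcup ball_ae) => x /= /eqP hx.
by have [k xk] := vball_exists x; exists k.
Qed.

End Vanishing.

Section FourierInjective.
Variables (R : realType) (p : nat).
Hypothesis hp : (1 < p)%N.
Local Notation G := (vilenkin p).
Local Notation w n := ((p%:R : R) ^ (- n)).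
Variable mu : {sigma_finite_measure set G -> \bar R}.
Hypothesis hmu : haar_measure mu.

Lemma cvge0_lt (u : nat -> \bar R) (e : R) : u @ \oo --> 0%E -> 0 < e ->
  \forall n \near \oo, (u n <= e%:E)%E.
Proof.
move=> u0 e0; near=> n; apply: ltW; near: n.
by apply: (u0 [set y | (y < e%:E)%E]); apply: open_ereal_lt'; rewrite lte_fin.
Unshelve. all: by end_near. Qed.

(** [h] is one real component of f, [v1 n + i v2 n] the approximants (multiplied by -i for the
    imaginary component), and [Q n] the squared modulus of the error. *)
Lemma real_fourier_injective (h : G -> R) (v1 v2 Q : nat -> G -> R) :
  measurable_fun [set: G] h ->
  (forall n, mu.-integrable setT (EFin \o v1 n)) ->
  (forall n, mu.-integrable setT (EFin \o v2 n)) ->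
  (forall n, measurable_fun [set: G] (Q n)) ->
  (forall n x, (h x - v1 n x) ^+ 2 <= Q n x) ->
  (\int[mu]_x (Q n x)%:E)%E @[n --> \oo] --> 0%E ->
  (\int[mu]_xi (fourier_re mu (v1 n) (v2 n) xi ^+ 2 +
      fourier_im mu (v1 n) (v2 n) xi ^+ 2)%:E)%E @[n --> \oo] --> 0%E ->
  {ae mu, forall x, h x = 0}.
Proof.
move=> mh iv1 iv2 mQ hQ Q0 F0.
have key a m e : 0 < e -> exists n,
    [/\ mu.-integrable (vball a (- m)) (EFin \o (fun x => h x - v1 n x)),
     `|\int[mu]_(x in vball a (- m)) (h x - v1 n x)| <= e * w (- m) + e &
     `|w m * \int[mu]_(x in vball a (- m)) v1 n x| <= e * w m + e].
  (* With tolerance e^2 on the squared norms, the term delta / e of the AM-GM bounds becomes [e]. *)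
  move=> e0; have e2 : 0 < e ^+ 2 by rewrite exprn_gt0.
  have [N _ hN] := cvge0_lt Q0 e2; have [N' _ hN'] := cvge0_lt F0 e2.
  pose n := maxn N N'; exists n.
  have eE : e ^+ 2 / e = e by rewrite expr2 mulfK// gt_eqF.
  have mB := vball_measurable a (- m).
  have mv1 : measurable_fun [set: G] (v1 n).
    by have /measurable_int/measurable_EFinP := iv1 n.
  have mhv : measurable_fun (vball a (- m)) (fun x => h x - v1 n x).
    by apply: measurable_funTS; exact: measurable_funB.
  have [i1 b1] := normr_Rintegral_le_sq mB (haar_vball_lty hp hmu a (- m)) mhv
    (mQ n) (hQ n) (hN n (leq_maxl _ _)) e0.
  split=> //.
    by move: b1; rewrite (haar_vballE hp hmu) eE.
  have := Rintegral_ball_le_fourier hp hmu (iv1 n) (iv2 n) a m e0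
    (hN' n (leq_maxr _ _)).
  by rewrite eE.
have split_h n : h = (fun x => (h x - v1 n x) + v1 n x).
  by apply/funext => x; rewrite subrK.
have iv1B n a m : mu.-integrable (vball a m) (EFin \o v1 n).
  by apply: integrableS (iv1 n) => //; exact: vball_measurable.
have ih a m : mu.-integrable (vball a m) (EFin \o h).
  have [n [+ _ _]] := key a (- m) 1 ltr01; rewrite opprK => i1.
  rewrite (_ : _ \o _ = fun x => ((h x - v1 n x)%:E + (v1 n x)%:E)%E);
    last first.
    by apply/funext => x; rewrite -EFinD subrK.
  by have := integrableD (vball_measurable a m) i1 (iv1B n a m); exact.
apply: ae_eq0_of_vball_integrals => // a m'.
rewrite -[m']opprK; set m := - m'.
have wm := radius_gt0 R hp m; have wm' := radius_gt0 R hp (- m).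
set I := Rintegral _ _ _.
(* Sum of the two bounds of [key]: the error contributes w m (e w(-m) + e), and the approximant e w
   m + e. *)
have bound e : 0 < e -> w m * `|I| <= e * (w m * (w (- m) + 2) + 1).
  move=> e0; have [n [i1 b1 b2]] := key a m e e0.
  have -> : I = \int[mu]_(x in vball a (- m)) (h x - v1 n x) +
      \int[mu]_(x in vball a (- m)) v1 n x.
    by rewrite /I {1}(split_h n) RintegralD//; exact: vball_measurable.
  move: b1 b2; set J := Rintegral _ _ _; set K := Rintegral _ _ _ => b1 b2.
  rewrite normrM (gtr0_norm wm) in b2.
  have := ler_normD J K; have := normr_ge0 J; have := normr_ge0 K.
  nra.
apply/eqP; rewrite -normr_eq0; apply/eqP/le_anti; rewrite normr_ge0 andbT.
apply/ler_addgt0Pr => e e0; rewrite add0r.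
set K := w m * (w (- m) + 2) + 1 in bound.
have K0 : 0 < K by rewrite /K; nra.
have eK : 0 < e * w m / K by rewrite divr_gt0// mulr_gt0.
by have := bound _ eK; rewrite divfK ?gt_eqF// mulrC ler_pM2r.
Qed.

End FourierInjective.

Section Modulus.
Variable R : realType.

Lemma modulus_sq (z : R[i]) :
  modulus z ^+ 2 = complex.Re z ^+ 2 + complex.Im z ^+ 2.
Proof.
by case: z => a b; rewrite /modulus/= sqr_sqrtr// addr_ge0 ?sqr_ge0.
Qed.

Lemma modulus_ge0 (z : R[i]) : 0 <= modulus z.
Proof. by case: z => a b; exact: sqrtr_ge0. Qed.

Lemma modulus_sq_eq0 (z : R[i]) : modulus z ^+ 2 = 0 -> z = 0.
Proof.
rewrite modulus_sq => /eqP; rewrite paddr_eq0 ?sqr_ge0// !sqrf_eq0.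
by case: z => a b /= /andP[/eqP -> /eqP ->].
Qed.

Lemma normr_Re_le (z : R[i]) : `|complex.Re z| <= modulus z.
Proof.
rewrite -(@ler_pXn2r _ 2) ?nnegrE ?modulus_ge0// modulus_sq.
by rewrite real_normK ?num_real// lerDl sqr_ge0.
Qed.

Lemma normr_Im_le (z : R[i]) : `|complex.Im z| <= modulus z.
Proof.
rewrite -(@ler_pXn2r _ 2) ?nnegrE ?modulus_ge0// modulus_sq.
by rewrite real_normK ?num_real// lerDr sqr_ge0.
Qed.

Lemma Re_sub (x y : R[i]) : complex.Re (x - y) = complex.Re x - complex.Re y.
Proof. by case: x; case: y. Qed.

Lemma Im_sub (x y : R[i]) : complex.Im (x - y) = complex.Im x - complex.Im y.
Proof. by case: x; case: y. Qed.

End Modulus.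

Section FourierL2.
Variables (R : realType) (p : nat).
Hypothesis hp : (1 < p)%N.
Local Notation G := (vilenkin p).

Lemma measurable_modulus_sq (f : G -> R[i]) : cmeasurable f ->
  measurable_fun [set: G] (fun x => modulus (f x) ^+ 2).
Proof.
move=> [mr mi]; under eq_fun do rewrite modulus_sq.
by apply: measurable_funD; exact: measurable_funX.
Qed.

Lemma cmeasurable_sub (f g : G -> R[i]) :
  cmeasurable f -> cmeasurable g -> cmeasurable (fun x => f x - g x).
Proof.
move=> [fr fi] [gr gi]; split.
  by under eq_fun do rewrite Re_sub; exact: measurable_funB.
by under eq_fun do rewrite Im_sub; exact: measurable_funB.
Qed.

Lemma inL1_integrable (mu : {measure set G -> \bar R}) (u : G -> R[i]) :
  inL1 mu u -> mu.-integrable setT (EFin \o (fun x => complex.Re (u x))) /\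
    mu.-integrable setT (EFin \o (fun x => complex.Im (u x))).
Proof.
move=> [[mr mi] ulty].
have mm : measurable_fun [set: G] (fun x => modulus (u x)).
  have -> : (fun x => modulus (u x)) = (fun x => Num.sqrt (modulus (u x) ^+ 2)).
    by apply/funext => x; rewrite sqrtr_sqr ger0_norm// modulus_ge0.
  apply: (measurableT_comp (continuous_measurable_fun (@sqrt_continuous R))).
  exact: measurable_modulus_sq.
have im : mu.-integrable setT (EFin \o (fun x => modulus (u x))).
  apply/integrableP; split; first exact/measurable_EFinP.
  by under eq_integral do rewrite gee0_abs ?lee_fin ?modulus_ge0//.
split; apply: le_integrable im => //; try exact/measurable_EFinP.
  by move=> x _; rewrite lee_fin (le_trans (normr_Re_le _))// ler_norm.
by move=> x _; rewrite lee_fin (le_trans (normr_Im_le _))// ler_norm.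
Qed.

Lemma fourierL1E (mu : {sigma_finite_measure set G -> \bar R})
    (u : G -> R[i]) xi :
  let v1 x := complex.Re (u x) in let v2 x := complex.Im (u x) in
  fourierL1 mu u xi = Complex (fourier_re mu v1 v2 xi) (fourier_im mu v1 v2 xi).
Proof.
move=> v1 v2; rewrite /fourierL1 /cintegral /fourier_re /fourier_im.
congr Complex; apply: eq_Rintegral => x _;
  rewrite /v1 /v2 /chi -/(@phase R p x xi);
  by case: (u x) => a b /=; ring.
Qed.

Lemma fourierL2_injective_sfinite (mu : {sigma_finite_measure set G -> \bar R})
    (f g : G -> R[i]) : haar_measure mu -> cmeasurable f ->
  is_fourierL2 mu f g -> {ae mu, forall x, g x = 0} ->
  {ae mu, forall x, f x = 0}.
Proof.
move=> hmu mf [[mg _] [u [uL uf ug]]] g0.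
have i1 n := (inL1_integrable (uL n).1).1.
have i2 n := (inL1_integrable (uL n).1).2.
pose v1 n x := complex.Re (u n x); pose v2 n x := complex.Im (u n x).
have i1N n : mu.-integrable setT (EFin \o (fun x => - v1 n x)).
  by have := integrableN (i1 n); exact.
pose S n xi := fourier_re mu (v1 n) (v2 n) xi ^+ 2 +
      fourier_im mu (v1 n) (v2 n) xi ^+ 2.
have mS n : measurable_fun [set: G] (S n).
  apply: measurable_funD; apply: measurable_funX.
    exact: measurable_fourier_re (i1 n) (i2 n).
  exact: measurable_fourier_im (i1 n) (i2 n).
have mum n : cmeasurable (u n) by case: (uL n) => -[].
have S0 : (\int[mu]_xi (S n xi)%:E)%E @[n --> \oo] --> 0%E.
  (* As [g] vanishes almost everywhere, the distance to [g] is the norm of the transform of [u n]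
     itself. *)
  have <- : (fun n => normL2sq mu (fun w => fourierL1 mu (u n) w - g w)) =
      (fun n => \int[mu]_xi (S n xi)%:E)%E; last exact: ug.
  apply/funext => n.
  have mF : cmeasurable (fourierL1 mu (u n)).
    split.
      under eq_fun do rewrite fourierL1E/=.
      exact: measurable_fourier_re (i1 n) (i2 n).
    under eq_fun do rewrite fourierL1E/=.
    exact: measurable_fourier_im (i1 n) (i2 n).
  apply: ge0_ae_eq_integral => //.
  - apply/measurable_EFinP; apply: measurable_modulus_sq.
    exact: cmeasurable_sub.
  - by apply/measurable_EFinP; exact: mS.
  - by move=> x _; rewrite lee_fin sqr_ge0.
  - by move=> x _; rewrite lee_fin addr_ge0 ?sqr_ge0.
  - apply: filterS g0 => xi gxi _.
    by rewrite gxi subr0 modulus_sq fourierL1E.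
pose Q n x := modulus (u n x - f x) ^+ 2.
have mQ n : measurable_fun [set: G] (Q n).
  by apply: measurable_modulus_sq; exact: cmeasurable_sub.
have Re0 : {ae mu, forall x, complex.Re (f x) = 0}.
  apply: (@real_fourier_injective R p hp mu hmu _ v1 v2 Q) => //.
    by case: mf.
  move=> n x; rewrite /Q modulus_sq Re_sub Im_sub -sqrrN opprB.
  by rewrite lerDl sqr_ge0.
have Im0 : {ae mu, forall x, complex.Im (f x) = 0}.
  (* The approximants are now v2 - i v1 = -i u, whose real part approximates the imaginary part of
     [f] and whose transform has the same modulus. *)
  apply: (@real_fourier_injective R p hp mu hmu _ v2 (fun n x => - v1 n x) Q
    mf.2 i2 i1N mQ _ uf).
  - move=> n x; rewrite /Q modulus_sq Re_sub Im_sub -sqrrN opprB.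
    by rewrite lerDr sqr_ge0.
  - rewrite [X in X @ _ --> _](_ : _ = (fun n => \int[mu]_xi (S n xi)%:E)%E);
      first exact: S0.
    apply/funext => n; apply: eq_integral => xi _; congr EFin.
    rewrite /S addrC; congr (_ + _).
      by rewrite /fourier_im (fourier_im_swap hp (i1 n) (i2 n)) sqrrN.
    rewrite /fourier_re /fourier_im; congr (_ ^+ 2).
    by apply: eq_Rintegral => x _; rewrite mulNr.
apply: filterS2 Re0 Im0 => x; case: (f x) => a b /= -> ->.
by [].
Qed.

(** Fubini asks for a sigma-finite structure, while the theorem speaks of a plain measure; the same
    set function is repackaged. *)
Lemma haar_sigma_finite_measure (mu : {measure set G -> \bar R}) :
  haar_measure mu ->
  exists smu : {sigma_finite_measure set G -> \bar R}, mu = smu.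
Proof.
move=> hmu.
have sf := haar_sigma_finite hp hmu.
pose H1 := isSFinite.Build _ _ _ _ (sfinite_measure_sigma_finite sf).
pose H2 := isSigmaFinite.Build _ _ _ _ sf.
pose smu := HB.pack_for (SigmaFiniteMeasure.type G R) (Measure.sort mu) H1 H2.
by exists smu; exact: eq_measure.
Qed.

Lemma fourierL2_injective (mu : {measure set G -> \bar R}) (f g : G -> R[i]) :
  haar_measure mu -> cmeasurable f -> is_fourierL2 mu f g ->
  {ae mu, forall x, g x = 0} -> {ae mu, forall x, f x = 0}.
Proof.
move=> hmu; have [smu E] := haar_sigma_finite_measure hmu.
by rewrite E in hmu *; exact: fourierL2_injective_sfinite.
Qed.

End FourierL2.

(** * Uncertainty products *)

Section Variance.
Variables (R : realType) (p : nat).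
Hypothesis hp : (1 < p)%N.
Local Notation G := (vilenkin p).
Variable mu : {measure set G -> \bar R}.
Hypothesis hmu : haar_measure mu.
Variable f : G -> R[i].
Hypothesis hf : inL2 mu f.

Let c : R := (fine (normL2sq mu f))^-1.

Let mg : measurable_fun [set: G] (fun x => modulus (f x) ^+ 2).
Proof. by case: hf => mf _; exact: measurable_modulus_sq. Qed.

Let g0 x : 0 <= modulus (f x) ^+ 2. Proof. exact: sqr_ge0. Qed.

Let c_ge0 : 0 <= c.
Proof.
by rewrite invr_ge0 fine_ge0// integral_ge0// => x _; rewrite lee_fin.
Qed.

Let dispersion_ge0 (rho : G -> R) a :
  (0 <= \int[mu]_x (rho (x - a)%R ^+ 2 * modulus (f x) ^+ 2)%:E)%E.
Proof. by apply: integral_ge0 => x _; rewrite lee_fin mulr_ge0 ?sqr_ge0. Qed.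

Lemma V_G_ge0 : (0 <= V_G mu f)%E.
Proof.
rewrite mule_ge0 ?lee_fin//; apply/ereal_infP => _ [a _ <-].
exact: dispersion_ge0.
Qed.

Lemma V_lambda_ge0 : (0 <= V_lambda mu f)%E.
Proof.
rewrite mule_ge0 ?lee_fin//; apply/ereal_infP => _ [a _ <-].
exact: dispersion_ge0.
Qed.

Lemma V_G_le : ((p%:R ^- 2)%:E * V_G mu f <= V_lambda mu f)%E.
Proof.
have p2 : (0 <= (p%:R ^- 2 : R)%:E)%E by rewrite lee_fin invr_ge0 exprn_ge0.
rewrite muleCA lee_wpmul2l ?lee_fin//; apply/ereal_infP => _ [a _ <-].
apply: le_trans (dispersion_vnorm_le hp mu mg g0 a).
by rewrite lee_wpmul2l//; apply: ereal_inf_lbound; exists a.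
Qed.

Hypothesis f_neq0 : ~ {ae mu, forall x, f x = 0}.

Let gne0 : ~ {ae mu, forall x, modulus (f x) ^+ 2 = 0}.
Proof.
by move=> h; apply: f_neq0; apply: filterS h => x; exact: modulus_sq_eq0.
Qed.

Let c_gt0 : 0 < c.
Proof.
rewrite invr_gt0 fine_gt0//; case: hf => _ ->; rewrite andbT.
have := @integral_weight_gt0 R p mu _ mg g0 gne0 (fun=> 1).
rewrite /normL2sq; under eq_integral do rewrite mul1r; apply => //.
rewrite (_ : [set x | _] = set0); first exact: negligible_set0.
by apply/seteqP; split=> // x /= /eqP; rewrite oner_eq0.
Qed.

Let V_G_attained : exists a, V_G mu f =
  (c%:E * \int[mu]_x (vnorm R (x - a)%R ^+ 2 * modulus (f x) ^+ 2)%:E)%E.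
Proof.
have [a amin] := dispersion_min_attained hp mg g0 gne0 hf.2.
exists a; congr (_ * _)%E; apply/le_anti/andP; split.
  by apply: ereal_inf_lbound; exists a.
by apply/ereal_infP => _ [b _ <-]; exact: amin.
Qed.

Lemma V_G_gt0 : (0 < V_G mu f)%E.
Proof.
have [a ->] := V_G_attained; rewrite mule_gt0 ?lte_fin//.
exact: (dispersion_vnorm_gt0 hp hmu mg g0 gne0).
Qed.

Lemma V_lambda_lt : (V_G mu f < +oo)%E -> (V_lambda mu f < V_G mu f)%E.
Proof.
have [a ->] := V_G_attained => aoo.
have Iaoo :
    (\int[mu]_x (vnorm R (x - a)%R ^+ 2 * modulus (f x) ^+ 2)%:E < +oo)%E.
  rewrite ltey; apply/eqP => Ia; move: aoo.
  by rewrite Ia gt0_muley ?lte_fin// ltxx.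
have lt_a := dispersion_lambda_lt hp hmu mg g0 gne0 Iaoo.
apply: (@le_lt_trans _ _
    (c%:E * \int[mu]_x (lambda R (x - a)%R ^+ 2 * modulus (f x) ^+ 2)%:E)%E).
  by rewrite lee_wpmul2l ?lee_fin//; apply: ereal_inf_lbound; exists a.
by rewrite lte_pmul2l// lte_fin.
Qed.

End Variance.

Theorem lemma1 (R : realType) (p : nat) (hp : (2 <= p)%N)
    (mu : {measure set (vilenkin p) -> \bar R}) (hmu : haar_measure mu)
    (f Ff : vilenkin p -> R[i])
    (hf : inL2 mu f) (hf0 : ~ {ae mu, forall x, f x = 0})
    (hFf : is_fourierL2 mu f Ff) :
  (((p%:R : R) ^- 4)%:E * UP_G mu f Ff <= UP_lambda mu f Ff)%E /\
  ((UP_G mu f Ff < +oo)%E -> (UP_lambda mu f Ff < UP_G mu f Ff)%E).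
Proof.
have hF : inL2 mu Ff by case: hFf.
have hF0 : ~ {ae mu, forall x, Ff x = 0}.
  by move=> h; apply: hf0; exact: (fourierL2_injective hp hmu hf.1 hFf h).
have p2 : (0 <= (p%:R ^- 2 : R)%:E)%E by rewrite lee_fin invr_ge0 exprn_ge0.
split.
  rewrite /UP_G /UP_lambda.
  have -> : ((p%:R : R) ^- 4)%:E = ((p%:R ^- 2)%:E * (p%:R ^- 2)%:E)%E.
    by rewrite -EFinM -invfM -exprD.
  rewrite muleACA; apply: lee_pmul.
  - by rewrite mule_ge0// V_G_ge0.
  - by rewrite mule_ge0// V_G_ge0.
  - exact: V_G_le.
  - exact: V_G_le.
have Vf := V_G_gt0 hp hmu hf hf0; have VF := V_G_gt0 hp hmu hF hF0.
rewrite /UP_G /UP_lambda => UPoo.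
(* An infinite factor times a positive one would make the product infinite. *)
have Vfoo : (V_G mu f < +oo)%E.
  by rewrite ltey; apply/eqP => h; move: UPoo; rewrite h gt0_mulye// ltxx.
have VFoo : (V_G mu Ff < +oo)%E.
  by rewrite ltey; apply/eqP => h; move: UPoo; rewrite h gt0_muley// ltxx.
apply: lte_pmul; rewrite ?V_lambda_ge0//; exact: V_lambda_lt.
Qed.
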